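(* If $\mathsf{NP}^{dy}\subseteq\mathsf{coNP}^{dy}$, then $\mathsf{PH}^{dy}=\mathsf{NP}^{dy}\cap\mathsf{coNP}^{dy}$.
   Context: Dynamic problems. A dynamic problem is a pair $\mathcal{D}=(\mathcal{P},\mathcal{G})$ where $\mathcal{P}$ maps bit-strings (instances) to answers ($\{0,1\}$ for decision problems) and $\mathcal{G}_n$ is a directed graph on $\{0,1\}^n$ whose edges are allowed instance-updates; $\mathcal{D}_n$ is the restriction to $n$-bit instances; an instance-sequence is a directed path $(I_0,\dots,I_k)$ in $\mathcal{G}_n$. Standing assumption: instance-updates are encodable in $\Theta(\log n)$ bits. The complement of a decision dynamic problem has the same update graphs and negated answers. Bit-probe algorithms. $\mathcal{A}_n$ operates on a bit array; at step $0$ it receives $I_0$ and initializes memory by an arbitrary function of $I_0$ (uncharged); at step $t\ge1$ it receives $(I_{t-1},I_t)$ (possibly with extra input) and runs a fixed decision tree of memory-bit reads (branching) and writes; output is read from a designated region. Update time = tree depth; space = number of memory bits. $\mathsf{P}^{dy}$: decision problems solvable (correct output $\mathcal{D}(I_t)$ at every step of every instance-sequence of length $\mathrm{poly}(n)$) with update time $O(\mathrm{polylog}\,n)$ and space $O(\mathrm{poly}\,n)$. Verifiers. $\mathcal{V}_n$ gets $I_0$ at step $0$ and outputs $(x_0,y_0)$; at step $t\ge1$ gets $((I_{t-1},I_t),\pi_t)$, $\pi_t\in\{0,1\}^{\mathrm{polylog}\,n}$, outputs $(x_t,y_t)$, $x_t\in\{0,1\}$, $y_t\in\{0,1\}^{\mathrm{polylog}\,n}$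 read as integer reward. A proof-sequence is reward-maximizing if each $\pi_t$ maximizes $y_t$ given the history. $\mathcal{D}\in\mathsf{NP}^{dy}$ iff a verifier-family with update time $O(\mathrm{polylog}\,n)$ and space $O(\mathrm{poly}\,n)$ satisfies: (1) for every proof-sequence, $x_t=0$ whenever $\mathcal{D}(I_t)=0$; (2) for reward-maximizing proof-sequences, $x_t=1$ whenever $\mathcal{D}(I_t)=1$. $\mathsf{coNP}^{dy}$: same with $0$ and $1$ exchanged in both $\mathcal{D}(I_t)$ and $x_t$. Oracles. An algorithm/verifier may use an oracle for $\mathcal{D}'$ on slice $\mathcal{D}'_m$, $m\le\mathrm{BlowUp}(n)$: it feeds an initial instance then instance-updates and reads the current answer; calls cost no time and oracle memory is not counted. $(\mathcal{C}_1)^{\mathcal{C}_2}$: problems meeting the definition of $\mathcal{C}_1$ when an oracle-family for some problem in $\mathcal{C}_2$ with blow-up $O(\mathrm{poly}\,n)$ may be used. $\Sigma_1=\mathsf{NP}^{dy}$, $\Pi_1=\mathsf{coNP}^{dy}$, $\Sigma_i=(\mathsf{NP}^{dy})^{\Sigma_{i-1}}$, $\Pi_i=(\mathsf{coNP}^{dy})^{\Sigma_{i-1}}$ for $i>1$, $\mathsf{PH}^{dy}=\bigcup_{i\ge1}(\Sigma_i\cup\Pi_i)$. *)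

(* Defs.v *)
From mathcomp Require Import all_boot.
From mathcomp Require Import classical_sets.

Set Implicit Arguments.
Unset Strict Implicit.
Unset Printing Implicit Defensive.

Local Open Scope classical_set_scope.

(* Asymptotics. The additive constant absorbs the finitely many n at which
   O(n^c), resp. O((log n)^c), imposes nothing. *)

Definition log2 (n : nat) : nat := trunc_log 2 n.

Definition poly_bounded (f : nat -> nat) : Prop :=
  exists c : nat, forall n : nat, f n <= c * n ^ c + c.

Definition polylog_bounded (f : nat -> nat) : Prop :=
  exists c : nat, forall n : nat, f n <= c * log2 n ^ c + c.

Definition theta_log (f : nat -> nat) : Prop :=
  exists a n0 : nat, forall n : nat, n0 <= n ->
    log2 n <= a * f n /\ f n <= a * log2 n.

Definition inst (n : nat) : Type := n.-tuple bool.

(* A decision dynamic problem. The encoding of instance-updates is part of the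
   problem: [ucode I J] is the bit-string presented to an algorithm when the
   instance changes from I to J. It has length Theta(log n) and, together with
   the current instance I, it determines J. *)
Record dynprob : Type := DynProb {
  ans : forall n : nat, inst n -> bool;
  upd : forall n : nat, rel (inst n);
  ulen : nat -> nat;
  ucode : forall n : nat, inst n -> inst n -> (ulen n).-tuple bool;
  ucode_inj : forall (n : nat) (I J K : inst n),
    upd I J -> upd I K -> ucode I J = ucode I K -> J = K;
  ulen_theta : theta_log ulen
}.

(* A stateful black box; [ofeed s w = None] means that w does not encode a
   legal instance-update in state s. *)
Record oracle : Type := Oracle {
  ostate : Type;
  ofeed : ostate -> bitseq -> option ostate;
  oans : ostate -> bool
}.

(* The oracle for the slice of D on m-bit instances; its state is the current
   instance. *)
Definition slice_oracle (D : dynprob) (m : nat) : oracle :=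
  @Oracle (inst m)
    (fun (J : inst m) (w : bitseq) =>
       [pick K : inst m | upd D J K & tval (ucode D J K) == w])
    (fun J : inst m => ans D J).

(* Absence of an oracle: nothing can be fed, and the answer is constant. *)
Definition no_oracle : oracle :=
  @Oracle unit (fun _ _ => None) (fun _ => false).

(* [Feed w t] feeds the oracle the instance-update encoded by w; [Ask t0 t1]
   branches on the oracle's answer on its current instance. *)
Inductive dtree : Type :=
| End
| Read of nat & dtree & dtree
| Write of nat & bool & dtree
| Feed of bitseq & dtree
| Ask of dtree & dtree.

(* A call contributes its node to the depth, so that the number of calls made
   in one step is bounded by the update time; the work done inside the oracle
   is not charged. *)
Fixpoint depth (T : dtree) : nat :=
  match T with
  | End => 0
  | Read _ t0 t1 => (maxn (depth t0) (depth t1)).+1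
  | Write _ _ t => (depth t).+1
  | Feed _ t => (depth t).+1
  | Ask t0 t1 => (maxn (depth t0) (depth t1)).+1
  end.

Fixpoint addr_below (s : nat) (T : dtree) : bool :=
  match T with
  | End => true
  | Read i t0 t1 => [&& i < s, addr_below s t0 & addr_below s t1]
  | Write i _ t => (i < s) && addr_below s t
  | Feed _ t => addr_below s t
  | Ask t0 t1 => addr_below s t0 && addr_below s t1
  end.

Definition memory : Type := nat -> bool.

Definition config (O : oracle) : Type := (memory * ostate O)%type.

(* [None] if an illegal update is fed to the oracle. *)
Fixpoint exec (O : oracle) (T : dtree) (c : config O) : option (config O) :=
  let: (m, s) := c in
  match T with
  | End => Some c
  | Read i t0 t1 => exec (if m i then t1 else t0) c
  | Write i b t => exec t ((fun j => if j == i then b else m j), s)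
  | Feed w t => if ofeed s w is Some s' then exec t (m, s') else None
  | Ask t0 t1 => exec (if oans s then t1 else t0) c
  end.

(* Writes w into the first [size w] cells. *)
Definition load (w : bitseq) (m : memory) : memory :=
  fun i => if i < size w then nth false w i else m i.

Definition nat_of_bits (w : bitseq) : nat :=
  foldr (fun (b : bool) (k : nat) => b + k.*2) 0 w.

(* A verifier for n-bit instances. Memory layout: cells 0, 1, ... hold the input
   of the current step (the code of the update followed by the proof); the next
   cell is x, and the [rlen] cells after it hold y, least significant bit first.
   Only cells below [space] count as memory; see [well_formed]. *)
Record verifier (O : oracle) (n : nat) : Type := Verifier {
  space : nat;
  plen : nat;
  rlen : nat;
  prep : inst n -> memory;
  oinit : inst n -> ostate O;
  tree : dtree
}.

(* The instances of steps 1, 2, ..., each with the proof given at that step. *)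
Definition history (O : oracle) (n : nat) (V : verifier O n) : Type :=
  seq (inst n * (plen V).-tuple bool).

Section Run.

Variables (D : dynprob) (O : oracle) (n : nat) (V : verifier O n).

Definition in_len : nat := ulen D n + plen V.

Definition well_formed : bool :=
  (in_len + (rlen V).+1 <= space V) && addr_below (space V) (tree V).

Definition step (I J : inst n) (p : (plen V).-tuple bool) (c : config O) :
    option (config O) :=
  exec (tree V) (load (ucode D I J ++ p) c.1, c.2).

Fixpoint run_from (c : config O) (I : inst n) (h : history V) :
    option (config O) :=
  if h is (J, p) :: h' then
    if step I J p c is Some c' then run_from c' J h' else None
  else Some c.

Definition run (I0 : inst n) (h : history V) : option (config O) :=
  run_from (prep V I0, oinit V I0) I0 h.

(* The output (x_t, y_t) at the last step t = size h. The default values are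
   irrelevant, since [verifies] asks every run to be defined. *)
Definition out_x (I0 : inst n) (h : history V) : bool :=
  if run I0 h is Some c then c.1 in_len else false.

Definition out_y (I0 : inst n) (h : history V) : nat :=
  if run I0 h is Some c then
    nat_of_bits [seq c.1 i | i <- iota in_len.+1 (rlen V)]
  else 0.

Definition instance_sequence (I0 : inst n) (h : history V) : bool :=
  path (@upd D n) I0 (unzip1 h).

Definition last_answer (I0 : inst n) (h : history V) : bool :=
  ans D (last I0 (unzip1 h)).

Definition reward_maximizing (I0 : inst n) (h : history V) : Prop :=
  forall (h1 h2 : history V) (J : inst n) (p : (plen V).-tuple bool),
    h = h1 ++ (J, p) :: h2 ->
    forall q : (plen V).-tuple bool,
      out_y I0 (rcons h1 (J, q)) <= out_y I0 (rcons h1 (J, p)).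

End Run.

(* Conditions on the family V, with b = true for NP and b = false for coNP.
   As prefixes of instance-sequences are instance-sequences, it suffices to
   speak of the output at the last step. The first conclusion says that only
   legal instance-updates are ever fed to the oracle. *)
Definition verifies (b : bool) (D : dynprob) (O : nat -> oracle)
    (V : forall n : nat, verifier (O n) n) : Prop :=
  forall L : nat -> nat, poly_bounded L ->
  forall (n : nat) (I0 : inst n) (h : history (V n)),
    size h <= L n -> instance_sequence D I0 h ->
    [/\ isSome (run D I0 h),
        last_answer D I0 h = ~~ b -> out_x D I0 h = ~~ b
      & reward_maximizing D I0 h -> last_answer D I0 h = b ->
        out_x D I0 h = b].

Definition has_verifier (b : bool) (O : nat -> oracle) (D : dynprob) : Prop :=
  exists V : forall n : nat, verifier (O n) n,
    [/\ forall n, well_formed D (V n),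
        polylog_bounded (fun n => depth (tree (V n))),
        poly_bounded (fun n => space (V n)),
        polylog_bounded (fun n => plen (V n)) /\
        polylog_bounded (fun n => rlen (V n))
      & verifies b D V].

Definition NPdy : set dynprob :=
  [set D | has_verifier true (fun=> no_oracle) D].

Definition coNPdy : set dynprob :=
  [set D | has_verifier false (fun=> no_oracle) D].

(* Verifiers with an oracle for some D' in C; the n-th verifier uses the slice
   of D' on m n bits. *)
Definition has_verifier_with (b : bool) (C : set dynprob) (D : dynprob) : Prop :=
  exists (D' : dynprob) (m : nat -> nat),
    [/\ C D', poly_bounded m
      & has_verifier b (fun n => slice_oracle D' (m n)) D].

Definition NPdy_with (C : set dynprob) : set dynprob :=
  [set D | has_verifier_with true C D].

Definition coNPdy_with (C : set dynprob) : set dynprob :=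
  [set D | has_verifier_with false C D].

(* Index 0 is a dummy value: the hierarchy starts at i = 1. *)
Fixpoint Sigmady (i : nat) : set dynprob :=
  match i with
  | 0 => set0
  | i'.+1 => if i' is 0 then NPdy else NPdy_with (Sigmady i')
  end.

Definition Pidy (i : nat) : set dynprob :=
  match i with
  | 0 => set0
  | i'.+1 => if i' is 0 then coNPdy else coNPdy_with (Sigmady i')
  end.

Definition PHdy : set dynprob :=
  \bigcup_(i in [set i | 1 <= i]) (Sigmady i `|` Pidy i).

(* Main.v *)
Require Import Defs.
From mathcomp Require Import all_boot zify.
From mathcomp Require Import boolp classical_sets.

(** Complementing a verifier amounts to storing its output bit x negated, so
    the hypothesis gives NP = coNP, and it remains to see that an oracle for a
    problem D' in NP and coNP can be dispensed with.

    Take verifiers W1 and W0 witnessing that D' is in NP and in coNP. The new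
    verifier simulates the oracle verifier V; at each feed it runs W1 and W0 on
    the update, with proofs supplied in separate slots of its own proof. At a
    query, x = 1 in W1 certifies the answer 1 and x = 0 in W0 certifies the
    answer 0; if neither holds, a flag is set for ever and the output is 0.
    Hence no proof-sequence makes the new verifier wrongly accept. The reward
    is lexicographic: whether all queries were certified, then the reward of V,
    then those of W1 and of W0, feed by feed. Optimal proofs for W1 and W0 make
    all queries certified whatever the proof of V is, so a reward-maximizing
    sequence is never flagged, is reward-maximizing for V, and, slot by slot,
    reward-maximizing for W1 and W0. *)

Set Implicit Arguments.
Unset Strict Implicit.
Unset Printing Implicit Defensive.

(** * Asymptotics *)

(** Up to conversion [poly_bounded] is the case [g = id] and [polylog_bounded] the case [g = log2],
    so closure properties are proved once for both. *)
Definition bounded_in (g f : nat -> nat) : Prop :=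
  exists c : nat, forall n : nat, f n <= c * g n ^ c + c.

Lemma leq_expn (m n e : nat) : m <= n -> m ^ e <= n ^ e.
Proof. by case: e => // e; rewrite leq_exp2r. Qed.

(** A bound by a single power is easier to multiply, compose and take logarithms of. *)
Lemma bounded_inP (g f : nat -> nat) :
  bounded_in g f <-> exists c, forall n, f n <= (g n + c) ^ c.
Proof.
split=> -[c fP].
(* The two extra factors, each at least [c.+2], absorb the coefficient and the additive constant. *)
- exists c.+2 => n; apply: leq_trans (fP n) _; set L := g n.
  have h1 : L ^ c <= (L + c.+2) ^ c by rewrite leq_expn // leq_addr.
  have h2 : 0 < (L + c.+2) ^ c by rewrite expn_gt0 addnS.
  rewrite !expnS; nia.
(* For [L = g n > 0] one has [L + c <= c.+1 * L], whence the coefficient [c.+1 ^ c]; for [L = 0] the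
   additive constant suffices. *)
exists ((c.+1) ^ c + c) => n; apply: leq_trans (fP n) _.
have [->|L_gt0] := posnP (g n).
  rewrite add0n; apply: leq_trans (leq_addl _ _).
  by apply: leq_trans (leq_addr _ _); rewrite leq_expn.
apply: leq_trans (leq_addr _ _); apply: leq_trans (_ : (c.+1 * g n) ^ c <= _).
  by apply: leq_expn; nia.
rewrite expnMn; apply: leq_mul; first exact: leq_addr.
by rewrite leq_pexp2l // leq_addl.
Qed.

Lemma bounded_in_le (g f1 f2 : nat -> nat) :
  (forall n, f1 n <= f2 n) -> bounded_in g f2 -> bounded_in g f1.
Proof. by move=> le12 [c cP]; exists c => n; apply: leq_trans (le12 n) _. Qed.

Lemma bounded_in_const (g : nat -> nat) (k : nat) : bounded_in g (fun=> k).
Proof. by exists k => n; apply: leq_addl. Qed.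

Lemma bounded_in_id (g : nat -> nat) : bounded_in g g.
Proof. by exists 1 => n; rewrite mul1n expn1 leq_addr. Qed.

Lemma leq_expn_shift (L c e : nat) :
  c <= e -> (L + c) ^ c <= (L + e.+1) ^ e.
Proof.
move=> le_ce; apply: leq_trans (_ : (L + e.+1) ^ c <= _).
  by apply: leq_expn; lia.
by rewrite leq_pexp2l // addnS.
Qed.

Lemma bounded_inD (g f1 f2 : nat -> nat) :
  bounded_in g f1 -> bounded_in g f2 -> bounded_in g (fun n => f1 n + f2 n).
Proof.
move=> /bounded_inP[c cP] /bounded_inP[e eP].
apply/bounded_inP; exists (c + e).+2 => n.
have h1 := leq_trans (cP n) (leq_expn_shift (g n) (leq_addr e c)).
have h2 := leq_trans (eP n) (leq_expn_shift (g n) (leq_addl c e)).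
have h3 : (g n + (c + e).+1) ^ (c + e) <= (g n + (c + e).+2) ^ (c + e).
  by apply: leq_expn; lia.
rewrite !expnS; nia.
Qed.

Lemma bounded_inM (g f1 f2 : nat -> nat) :
  bounded_in g f1 -> bounded_in g f2 -> bounded_in g (fun n => f1 n * f2 n).
Proof.
move=> /bounded_inP[c cP] /bounded_inP[e eP].
apply/bounded_inP; exists (c + e) => n.
rewrite expnD; apply: leq_mul.
  by apply: leq_trans (cP n) _; apply: leq_expn; lia.
by apply: leq_trans (eP n) _; apply: leq_expn; lia.
Qed.

Lemma bounded_inX (g f : nat -> nat) (k : nat) :
  bounded_in g f -> bounded_in g (fun n => f n ^ k).
Proof.
move=> fP; elim: k => [|k IHk]; first exact: bounded_in_const.
by apply: bounded_in_le (bounded_inM fP IHk) => n; rewrite expnS.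
Qed.

Lemma bounded_in_trans (g g' f : nat -> nat) :
  bounded_in g g' -> bounded_in g' f -> bounded_in g f.
Proof.
move=> gP [c cP]; apply: bounded_in_le cP _.
apply: bounded_inD (bounded_in_const _ _).
exact: bounded_inM (bounded_in_const _ _) (bounded_inX _ gP).
Qed.

Lemma bounded_in_comp (g f m : nat -> nat) :
  bounded_in g f -> bounded_in (fun n => g (m n)) (fun n => f (m n)).
Proof. by case=> c cP; exists c => n; apply: cP. Qed.

Lemma log2_leq (n : nat) : log2 n <= n.
Proof.
case: n => // n; apply: leq_trans (trunc_logP (isT : 1 < 2) (ltn0Sn n)).
by rewrite ltnW // ltn_expl.
Qed.

Lemma polylog_poly (f : nat -> nat) : polylog_bounded f -> poly_bounded f.
Proof.
apply: (@bounded_in_trans id log2).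
by apply: bounded_in_le log2_leq (bounded_in_id _).
Qed.

Lemma log2_poly (m : nat -> nat) :
  poly_bounded m -> polylog_bounded (fun n => log2 (m n)).
Proof.
move=> /(bounded_inP id)[c cP].
apply: (@bounded_in_le _ _ (fun n => c * (log2 n + 1 + c)) _); last first.
  apply: bounded_inM (bounded_in_const _ _) _.
  apply: bounded_inD (bounded_in_const _ _).
  exact: bounded_inD (bounded_in_id _) (bounded_in_const _ _).
move=> n; rewrite -[leqRHS](@trunc_expnK 2) //.
apply: leq_trunc_log; apply: leq_trans (cP n) _.
rewrite mulnC expnM; apply: leq_expn => /=.
(* The sum [n + c] is at most the product of two powers of 2 exceeding [n] and [c]. *)
have h : n < 2 ^ (log2 n + 1) by rewrite addn1; exact: trunc_log_ltn.
have h2 : c < 2 ^ c by rewrite ltn_expl.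
rewrite expnD; nia.
Qed.

Lemma polylog_comp (f m : nat -> nat) :
  polylog_bounded f -> poly_bounded m -> polylog_bounded (fun n => f (m n)).
Proof.
move=> fP mP; apply: bounded_in_trans (log2_poly mP) _.
exact: bounded_in_comp.
Qed.

Lemma poly_comp (f m : nat -> nat) :
  poly_bounded f -> poly_bounded m -> poly_bounded (fun n => f (m n)).
Proof.
move=> fP mP; apply: (@bounded_in_trans id m) => //.
exact: (@bounded_in_comp id).
Qed.

Lemma theta_log_polylog (f : nat -> nat) : theta_log f -> polylog_bounded f.
Proof.
case=> a [n0 fP].
(* The constant sum covers the finitely many arguments below [n0]. *)
apply: (@bounded_in_le _ _ (fun n => a * log2 n + \sum_(i < n0) f i)).
  move=> n; have [le_n|lt_n] := leqP n0 n.
    by case: (fP n le_n) => _ h; apply: leq_trans h (leq_addr _ _).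
  apply: leq_trans (leq_addl _ _).
  by rewrite (bigD1 (Ordinal lt_n)) //= leq_addr.
apply: bounded_inD (bounded_in_const _ _).
exact: bounded_inM (bounded_in_const _ _) (bounded_in_id _).
Qed.

(** * Runs *)

Section RunLemmas.

Variables (D : dynprob) (O : oracle) (n : nat) (V : verifier O n).
Implicit Types (h : history V) (I J : inst n) (p : (plen V).-tuple bool).

Lemma run_from_cat c I h1 h2 :
  run_from D c I (h1 ++ h2) =
  if run_from D c I h1 is Some c' then run_from D c' (last I (unzip1 h1)) h2
  else None.
Proof.
elim: h1 c I => //= -[J p] h1 IH c I.
by case: (step _ _ _ _) => // c'; rewrite IH.
Qed.

Lemma run_rcons I0 h J p :
  run D I0 (rcons h (J, p)) =
  if run D I0 h is Some c then step D (last I0 (unzip1 h)) J p c else None.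
Proof.
rewrite /run -cats1 run_from_cat; case: (run_from _ _ _ _) => //= c.
by case: (step _ _ _ _).
Qed.

Lemma unzip1_rcons h J p : unzip1 (rcons h (J, p)) = rcons (unzip1 h) J.
Proof. by rewrite /unzip1 map_rcons. Qed.

Lemma instance_sequence_rcons I0 h J p :
  instance_sequence D I0 (rcons h (J, p)) =
  instance_sequence D I0 h && upd D (last I0 (unzip1 h)) J.
Proof. by rewrite /instance_sequence unzip1_rcons rcons_path. Qed.

Lemma reward_maximizing_nil I0 : reward_maximizing (V := V) D I0 [::].
Proof. by move=> [|? ?] //. Qed.

Lemma reward_maximizing_catl I0 h1 h2 :
  reward_maximizing D I0 (h1 ++ h2) -> reward_maximizing D I0 h1.
Proof.
by move=> hm h3 h4 J p e q; apply: (hm h3 (h4 ++ h2)); rewrite e -catA.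
Qed.

Lemma reward_maximizing_rcons I0 h J p :
  reward_maximizing D I0 (rcons h (J, p)) <->
  reward_maximizing D I0 h /\
  forall q, out_y D I0 (rcons h (J, q)) <= out_y D I0 (rcons h (J, p)).
Proof.
split=> [hm|[hm mp]].
  split=> [h1 h2 K r e q|q]; last by apply: (hm h [::]); rewrite cats1.
  by apply: (hm h1 (rcons h2 (J, p))); rewrite e rcons_cat.
move=> h1 h2 K r; case/lastP: h2 => [|h2 x].
  by rewrite cats1 => /rcons_inj[<- <- <-].
by rewrite -rcons_cons -rcons_cat => /rcons_inj[e _]; apply: hm e.
Qed.

Lemma exists_best_proof I0 h J :
  exists p, forall q, out_y D I0 (rcons h (J, q)) <= out_y D I0 (rcons h (J, p)).
Proof.
pose F p := out_y D I0 (rcons h (J, p)).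
pose p0 : (plen V).-tuple bool := nseq_tuple _ false.
by exists [arg max_(p > p0) F p] => q; case: arg_maxnP => // p _; apply.
Qed.

End RunLemmas.

(* The length bound in [verifies] is void: a constant L admits any given h. *)
Lemma verifies_any_length b D (O : nat -> oracle)
    (V : forall n, verifier (O n) n) :
  verifies b D V ->
  forall n (I0 : inst n) (h : history (V n)), instance_sequence D I0 h ->
    [/\ isSome (run D I0 h),
        last_answer D I0 h = ~~ b -> out_x D I0 h = ~~ b
      & reward_maximizing D I0 h -> last_answer D I0 h = b ->
        out_x D I0 h = b].
Proof.
move=> VP n I0 h hP; apply: (VP (fun=> size h)) => //.
exact: bounded_in_const id _.
Qed.

(** * Complements *)

Definition compl (D : dynprob) : dynprob :=
  @DynProb (fun n I => ~~ ans D I) (@upd D) (ulen D) (@ucode D) (@ucode_inj D)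
    (@ulen_theta D).

(** Conjugates [T] by [flip_mem x]. A read of [x] is answered by swapping the branches, so no depth
    is added. *)
Fixpoint flip_tree (x : nat) (T : dtree) : dtree :=
  match T with
  | End => End
  | Read i t0 t1 => if i == x then Read i (flip_tree x t1) (flip_tree x t0)
                    else Read i (flip_tree x t0) (flip_tree x t1)
  | Write i b t => Write i (b (+) (i == x)) (flip_tree x t)
  | Feed w t => Feed w (flip_tree x t)
  | Ask t0 t1 => Ask (flip_tree x t0) (flip_tree x t1)
  end.

Definition flip_mem (x : nat) (m : memory) : memory := fun i => m i (+) (i == x).

Lemma depth_flip x T : depth (flip_tree x T) = depth T.
Proof.
elim: T => //= [i t0 <- t1 <-|i b t ->|w t ->|t0 -> t1 ->] //.
by case: ifP => //= _; rewrite maxnC.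
Qed.

Lemma addr_below_flip s x T : addr_below s (flip_tree x T) = addr_below s T.
Proof.
elim: T => //= [i t0 <- t1 <-|i b t ->|t0 -> t1 ->] //.
by case: ifP => //= _; congr (_ && _); rewrite andbC.
Qed.

Lemma exec_flip O x T (m : memory) (s : ostate O) :
  exec (flip_tree x T) (flip_mem x m, s) =
  omap (fun c : config O => (flip_mem x c.1, c.2)) (exec T (m, s)).
Proof.
elim: T m s => //= [i t0 IH0 t1 IH1|i b t IH|w t IH|t0 IH0 t1 IH1] m s.
- have fE : flip_mem x m i = m i (+) (i == x) by [].
  by case: ifP fE => _ /= ->; rewrite ?addbT ?addbF; case: (m i) => /=.
- rewrite -IH; congr (exec _ (_, _)); apply: funext => j; rewrite /flip_mem.
  by case: (j =P i) => [->|].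
- by case: (ofeed s w) => //=.
by case: (oans s).
Qed.

Definition flip_verifier (x : nat) O n (V : verifier O n) : verifier O n :=
  Verifier (space V) (plen V) (rlen V) (fun I => flip_mem x (prep V I))
    (oinit V) (flip_tree x (tree V)).

Section Flip.

Variables (D : dynprob) (O : oracle) (n : nat) (V : verifier O n).

Let F := flip_verifier (in_len D V) V.

(** Loading the input touches only cells below [in_len], whereas the negated cell is [in_len]
    itself, so the correspondence survives from step to step. *)
Lemma run_flip (I0 : inst n) (h : history V) :
  run (V := F) D I0 h =
  omap (fun c : config O => (flip_mem (in_len D V) c.1, c.2)) (run D I0 h).
Proof.
elim/last_ind: h => [//|h [J p] IH]; rewrite !run_rcons IH.
case: (run D I0 h) => //= -[m s]; rewrite /step -exec_flip /=.
congr (exec _ (_, _)); apply: funext => j; rewrite /load /flip_mem.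
rewrite size_cat !size_tuple; case: ifP => // lt_j.
by rewrite /in_len ltn_eqF // addbF.
Qed.

Lemma out_x_flip (I0 : inst n) (h : history V) :
  isSome (run D I0 h) -> out_x (V := F) D I0 h = ~~ out_x D I0 h.
Proof.
rewrite /out_x run_flip; case: (run D I0 h) => //= -[m s] _.
by rewrite /flip_mem eqxx addbT.
Qed.

Lemma out_y_flip (I0 : inst n) (h : history V) :
  out_y (V := F) D I0 h = out_y D I0 h.
Proof.
rewrite /out_y run_flip; case: (run D I0 h) => //= -[m s].
congr nat_of_bits; apply/eq_in_map => i; rewrite mem_iota => /andP[lt_i _].
by rewrite /flip_mem gtn_eqF ?addbF.
Qed.

End Flip.

Section FlipFamily.

Variables (b : bool) (D : dynprob) (O : nat -> oracle).
Variable V : forall n, verifier (O n) n.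

Let F n := flip_verifier (in_len D (V n)) (V n).

Lemma flip_spec : verifies b D V ->
  forall n (I0 : inst n) (h : history (F n)), instance_sequence D I0 h ->
    [/\ isSome (run D I0 h),
        last_answer D I0 h = ~~ b -> out_x D I0 h = b
      & reward_maximizing D I0 h -> last_answer D I0 h = b ->
        out_x D I0 h = ~~ b].
Proof.
move=> VP n I0 h hP.
have [def xP yP] := @verifies_any_length _ _ _ _ VP n I0 h hP.
split; first by rewrite run_flip; case: (run (V := V n) D I0 h) def.
  by move=> /xP; rewrite out_x_flip // => ->; rewrite negbK.
move=> hm hb; rewrite out_x_flip // yP // => h1 h2 J p e q.
by have := hm h1 h2 J p e q; rewrite !out_y_flip.
Qed.

End FlipFamily.

Lemma has_verifier_compl b O D :
  has_verifier b O D -> has_verifier (~~ b) O (compl D).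
Proof.
case=> V [Vwf Vd Vs Vpr VP].
exists (fun n => flip_verifier (in_len D (V n)) (V n)); split => //.
- by move=> n; rewrite /well_formed /= addr_below_flip; apply: Vwf.
- by under eq_fun do rewrite /= depth_flip.
move=> L _ n I0 h _ hP.
have [def xP yP] := flip_spec VP hP.
split; first exact: def.
  by rewrite negbK => h1; apply: xP; rewrite -h1 /last_answer /= negbK.
by move=> hm h1; apply: yP => //; apply: negb_inj.
Qed.

(** Stated separately because [compl (compl D)] is not convertible to [D]. *)
Lemma has_verifier_compl_inv b O D :
  has_verifier b O (compl D) -> has_verifier (~~ b) O D.
Proof.
case=> V [Vwf Vd Vs Vpr VP].
exists (fun n => flip_verifier (in_len D (V n)) (V n)); split => //.
- by move=> n; rewrite /well_formed /= addr_below_flip; apply: Vwf.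
- by under eq_fun do rewrite /= depth_flip.
move=> L _ n I0 h _ hP.
have [def xP yP] := flip_spec VP hP.
split; first exact: def.
  by rewrite negbK => h1; apply: xP; rewrite -h1.
by move=> hm h1; apply: yP => //; rewrite /last_answer /= in h1 *; rewrite h1 negbK.
Qed.

(** * Lexicographic rewards *)

(** The decoding used by [out_y], for an arbitrary block of cells; higher cells have higher
    weight. *)
Definition cell_val (m : memory) (a l : nat) : nat :=
  nat_of_bits [seq m i | i <- iota a l].

Lemma nat_of_bits_cat (u v : bitseq) :
  nat_of_bits (u ++ v) = nat_of_bits u + 2 ^ size u * nat_of_bits v.
Proof. by elim: u => [|b u IH] /=; rewrite ?mul1n // IH expnS; lia. Qed.

Lemma nat_of_bits_lt (u : bitseq) : nat_of_bits u < 2 ^ size u.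
Proof. by elim: u => //= b u IH; rewrite expnS; case: b; lia. Qed.

Lemma cell_valD (m : memory) (a l1 l2 : nat) :
  cell_val m a (l1 + l2) = cell_val m a l1 + 2 ^ l1 * cell_val m (a + l1) l2.
Proof. by rewrite /cell_val iotaD map_cat nat_of_bits_cat size_map size_iota. Qed.

Lemma cell_val_lt (m : memory) (a l : nat) : cell_val m a l < 2 ^ l.
Proof.
by apply: leq_trans (nat_of_bits_lt _) _; rewrite size_map size_iota.
Qed.

Lemma eq_cell_val (m m' : memory) (a a' l : nat) :
  (forall i, i < l -> m (a + i) = m' (a' + i)) -> cell_val m a l = cell_val m' a' l.
Proof.
move=> eqm; rewrite /cell_val -[a]addn0 -[a' in RHS]addn0 !iotaDl -!map_comp.
by congr nat_of_bits; apply/eq_in_map => i; rewrite mem_iota => /eqm.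
Qed.

Lemma cell_val0 (m : memory) (a l : nat) :
  (forall i, i < l -> m (a + i) = false) -> cell_val m a l = 0.
Proof.
move=> m0; rewrite (@eq_cell_val m (fun=> false) a a l) // /cell_val.
by elim: l a {m0} => //= l IH a; rewrite IH.
Qed.

Lemma cell_val1 (m : memory) (a : nat) : cell_val m a 1 = m a.
Proof. by rewrite /cell_val /= addn0. Qed.

(** If [u] were at least [u'.+1], then [B * u] alone would exceed [v' + B * u']. *)
Lemma leq_lex (B u v u' v' : nat) :
  v' < B -> v + B * u <= v' + B * u' -> u <= u'.
Proof. by move=> lt_v le_uv; rewrite leqNgt; apply/negP => lt_u; nia. Qed.

Section LexMax.

Variables (D : dynprob) (O : oracle) (n : nat) (V : verifier O n).
Variable (I0 : inst n).
Implicit Types (h : history V) (K : inst n) (Ks : seq (inst n)).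
Implicit Types pi : nat -> (plen V).-tuple bool.

(* The proofs are drawn from slots k.-1, k.-2, ... *)
Fixpoint entries pi k Ks : history V :=
  if Ks is K :: Ks' then (K, pi k.-1) :: entries pi k.-1 Ks' else [::].

(* The reward of slot e has weight 2 ^ (e * rlen V). *)
Fixpoint slots_reward h pi k Ks : nat :=
  if Ks is K :: Ks' then
    let h' := rcons h (K, pi k.-1) in
    slots_reward h' pi k.-1 Ks' + 2 ^ (k.-1 * rlen V) * out_y D I0 h'
  else 0.

Lemma out_y_lt h : out_y D I0 h < 2 ^ rlen V.
Proof.
rewrite /out_y; case: (run _ _ _) => [c|]; last by rewrite expn_gt0.
by apply: leq_trans (nat_of_bits_lt _) _; rewrite size_map size_iota.
Qed.

Lemma slots_reward_lt h pi k Ks :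
  size Ks <= k -> slots_reward h pi k Ks < 2 ^ (k * rlen V).
Proof.
elim: Ks k h => [|K Ks IH] [|k] h //= le_k; rewrite ?expn_gt0 //.
have := IH k (rcons h (K, pi k)) le_k.
have := out_y_lt (rcons h (K, pi k)).
by rewrite mulSn expnD; nia.
Qed.

Lemma eq_entries pi pi' k Ks : size Ks <= k ->
  (forall e, e < k -> pi e = pi' e) -> entries pi k Ks = entries pi' k Ks.
Proof.
elim: Ks k => [|K Ks IH] [|k] //= le_k e; rewrite e // (IH k) // => i lt_i.
by apply: e; apply: ltnW.
Qed.

Lemma eq_slots_reward h pi pi' k Ks : size Ks <= k ->
  (forall e, e < k -> pi e = pi' e) ->
  slots_reward h pi k Ks = slots_reward h pi' k Ks.
Proof.
elim: Ks k h => [|K Ks IH] [|k] h //= le_k e; rewrite e //.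
by rewrite (IH k) // => i lt_i; apply: e; apply: ltnW.
Qed.

(** Greedy choice: a best proof for the first instance goes to the top slot, and the recursion fills
    only lower slots. *)
Lemma exists_best_entries h k Ks : size Ks <= k ->
  reward_maximizing D I0 h ->
  exists pi, reward_maximizing D I0 (h ++ entries pi k Ks).
Proof.
elim: Ks k h => [|K Ks IH] [|k] h //= le_k hm.
- by exists (fun=> nseq_tuple _ false); rewrite cats0.
- by exists (fun=> nseq_tuple _ false); rewrite cats0.
have [p pm] := exists_best_proof D I0 h K.
have hm' : reward_maximizing D I0 (rcons h (K, p)).
  by apply/reward_maximizing_rcons.
have [pi piP] := IH k _ le_k hm'.
exists (fun e => if e == k then p else pi e); rewrite eqxx -cat_rcons.
by rewrite (@eq_entries _ pi) // => e lt_e; rewrite ltn_eqF.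
Qed.

(* The first slot must be optimal, as it has the largest weight and can be
   followed by optimal proofs; then only the remaining slots matter. *)
Lemma lex_maximizing h pi k Ks : size Ks <= k ->
  reward_maximizing D I0 h ->
  (forall pi', reward_maximizing D I0 (h ++ entries pi' k Ks) ->
     slots_reward h pi' k Ks <= slots_reward h pi k Ks) ->
  reward_maximizing D I0 (h ++ entries pi k Ks).
Proof.
elim: Ks k h => [|K Ks IH] [|k] h //= le_k hm piP; rewrite ?cats0 //.
have mp : reward_maximizing D I0 (rcons h (K, pi k)).
  apply/reward_maximizing_rcons; split=> // q.
  have [p pm] := exists_best_proof D I0 h K.
  apply: leq_trans (pm q) _.
  have hm' : reward_maximizing D I0 (rcons h (K, p)).
    by apply/reward_maximizing_rcons.
  have [pi' pi'P] := exists_best_entries le_k hm'.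
  pose pi2 e := if e == k then p else pi' e.
  have e2 e : e < k -> pi2 e = pi' e by move=> lt_e; rewrite /pi2 ltn_eqF.
  have e2k : pi2 k = p by rewrite /pi2 eqxx.
  have := piP pi2; rewrite e2k -cat_rcons (@eq_entries _ pi') // => /(_ pi'P).
  exact: leq_lex (slots_reward_lt _ _ le_k).
rewrite -cat_rcons; apply: IH => // pi' pi'P.
pose pi2 e := if e == k then pi k else pi' e.
have e2 e : e < k -> pi2 e = pi' e by move=> lt_e; rewrite /pi2 ltn_eqF.
have e2k : pi2 k = pi k by rewrite /pi2 eqxx.
have := piP pi2; rewrite e2k -cat_rcons (@eq_entries _ pi') //.
move=> /(_ pi'P); rewrite leq_add2r.
by rewrite (@eq_slots_reward _ pi2 pi').
Qed.

End LexMax.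

(** * Oracle-free trees *)

Definition set_cell (m : memory) (i : nat) (b : bool) : memory :=
  fun j => if j == i then b else m j.

(* Agrees with [exec] in the absence of an oracle, where [Ask] answers false;
   it is total because [Feed] is skipped. *)
Fixpoint sem (T : dtree) (m : memory) : memory :=
  match T with
  | End => m
  | Read i t0 t1 => sem (if m i then t1 else t0) m
  | Write i b t => sem t (set_cell m i b)
  | Feed _ t => sem t m
  | Ask t0 _ => sem t0 m
  end.

Fixpoint oracle_free (T : dtree) : bool :=
  match T with
  | End => true
  | Read _ t0 t1 => oracle_free t0 && oracle_free t1
  | Write _ _ t => oracle_free t
  | Feed _ _ => false
  | Ask _ _ => false
  end.

Lemma exec_no_oracle T (m : memory) s (c : config no_oracle) :
  exec (O := no_oracle) T (m, s) = Some c -> c.1 = sem T m.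
Proof.
elim: T m s => //= [m s [<-] //|i t0 IH0 t1 IH1 m s|i b t IH m s /IH //].
by case: (m i) => [/IH1|/IH0].
Qed.

Lemma exec_oracle_free O T (m : memory) (s : ostate O) :
  oracle_free T -> exec T (m, s) = Some (sem T m, s).
Proof.
elim: T m s => //= [i t0 IH0 t1 IH1 m s /andP[f0 f1]|i b t IH m s f].
  by case: (m i); [apply: IH1|apply: IH0].
exact: IH.
Qed.

(** The continuation is duplicated at every bit, so the tree grows exponentially; the depth, which
    alone counts as time, grows by two per bit. *)
Fixpoint copy_block (f g : nat -> nat) (l : nat) (K : dtree) : dtree :=
  if l is l'.+1 then
    let K' := copy_block f g l' K in
    Read (f l') (Write (g l') false K') (Write (g l') true K')
  else K.

Fixpoint set_block (g : nat -> nat) (v : nat -> bool) (l : nat) (K : dtree) :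
    dtree :=
  if l is l'.+1 then Write (g l') (v l') (set_block g v l' K) else K.

(* Runs T on the memory whose cell i is stored at f i, and then K. *)
Fixpoint graft (f : nat -> nat) (T K : dtree) : dtree :=
  match T with
  | End => K
  | Read i t0 t1 => Read (f i) (graft f t0 K) (graft f t1 K)
  | Write i b t => Write (f i) b (graft f t K)
  | Feed _ t => graft f t K
  | Ask t0 _ => graft f t0 K
  end.

Lemma depth_copy_block f g l K : depth (copy_block f g l K) = l.*2 + depth K.
Proof. by elim: l => //= l ->; rewrite maxnn. Qed.

Lemma depth_set_block g v l K : depth (set_block g v l K) = l + depth K.
Proof. by elim: l => //= l ->. Qed.

Lemma depth_graft f T K : depth (graft f T K) <= depth T + depth K.
Proof. by elim: T => //= *; lia. Qed.

Lemma free_copy_block f g l K : oracle_free (copy_block f g l K) = oracle_free K.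
Proof. by elim: l => //= l ->; rewrite andbb. Qed.

Lemma free_set_block g v l K : oracle_free (set_block g v l K) = oracle_free K.
Proof. by elim: l. Qed.

Lemma free_graft f T K : oracle_free K -> oracle_free (graft f T K).
Proof. by move=> fK; elim: T => //= i t0 -> t1 ->. Qed.

Lemma below_copy_block s f g l K :
  (forall i, i < l -> (f i < s) && (g i < s)) -> addr_below s K ->
  addr_below s (copy_block f g l K).
Proof.
move=> fg sK; elim: l fg => //= l IH fg; have /andP[-> ->] := fg l (leqnn _).
by rewrite IH // => i lt_i; apply: fg; apply: ltnW.
Qed.

Lemma below_set_block s g v l K :
  (forall i, i < l -> g i < s) -> addr_below s K ->
  addr_below s (set_block g v l K).
Proof.
move=> gs sK; elim: l gs => //= l IH gs; rewrite gs // IH // => i lt_i.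
by apply: gs; apply: ltnW.
Qed.

Lemma below_graft s s' f T K :
  (forall i, i < s' -> f i < s) -> addr_below s' T -> addr_below s K ->
  addr_below s (graft f T K).
Proof.
move=> fs + sK; elim: T => //= [i t0 IH0 t1 IH1|i b t IH|t0 IH0 t1 _].
- by case/and3P => /fs -> /IH0 -> /IH1 ->.
- by case/andP => /fs -> /IH ->.
by case/andP => /IH0.
Qed.

Fixpoint copy_mem (f g : nat -> nat) (l : nat) (m : memory) : memory :=
  if l is l'.+1 then copy_mem f g l' (set_cell m (g l') (m (f l'))) else m.

Fixpoint set_mem (g : nat -> nat) (v : nat -> bool) (l : nat) (m : memory) :
    memory :=
  if l is l'.+1 then set_mem g v l' (set_cell m (g l') (v l')) else m.

Lemma sem_copy_block f g l K m :
  sem (copy_block f g l K) m = sem K (copy_mem f g l m).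
Proof. by elim: l m => //= l IH m; case: (m (f l)) => /=; rewrite IH. Qed.

Lemma sem_set_block g v l K m :
  sem (set_block g v l K) m = sem K (set_mem g v l m).
Proof. by elim: l m => //= l IH m. Qed.

Lemma sem_graft f T K m : sem (graft f T K) m = sem K (sem (graft f T End) m).
Proof. by elim: T m => //= i t0 IH0 t1 IH1 m; case: (m (f i)). Qed.

Lemma copy_mem_out f g l m j :
  (forall i, i < l -> j <> g i) -> copy_mem f g l m j = m j.
Proof.
elim: l m => //= l IH m gj; rewrite IH => [|i lt_i]; last by apply: gj; lia.
by rewrite /set_cell; case: eqP => // /gj; case.
Qed.

Lemma copy_mem_in f g l m i :
  (forall i j, i < l -> j < l -> g i = g j -> i = j) ->
  (forall i j, i < l -> j < l -> f i <> g j) ->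
  i < l -> copy_mem f g l m (g i) = m (f i).
Proof.
elim: l m => //= l IH m gi fg; rewrite ltnS leq_eqVlt => /predU1P[->|lt_i].
  rewrite copy_mem_out; first by rewrite /set_cell eqxx.
  by move=> j lt_j /gi e; have := e _ _; lia.
rewrite IH //; last 2 first.
- by move=> a b ? ?; apply: gi; lia.
- by move=> a b ? ?; apply: fg; lia.
by rewrite /set_cell; case: eqP => // /fg; case; lia.
Qed.

Lemma set_mem_out g v l m j :
  (forall i, i < l -> j <> g i) -> set_mem g v l m j = m j.
Proof.
elim: l m => //= l IH m gj; rewrite IH => [|i lt_i]; last by apply: gj; lia.
by rewrite /set_cell; case: eqP => // /gj; case.
Qed.

Lemma set_mem_in g v l m i :
  (forall i j, i < l -> j < l -> g i = g j -> i = j) ->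
  i < l -> set_mem g v l m (g i) = v i.
Proof.
elim: l m => //= l IH m gi; rewrite ltnS leq_eqVlt => /predU1P[->|lt_i].
  rewrite set_mem_out; first by rewrite /set_cell eqxx.
  by move=> j lt_j /gi e; have := e _ _; lia.
by rewrite IH // => a b ? ?; apply: gi; lia.
Qed.

Lemma graft_in f T m : injective f ->
  (fun i => sem (graft f T End) m (f i)) = sem T (fun i => m (f i)).
Proof.
move=> fi; elim: T m => //= [i t0 IH0 t1 IH1 m|i b t IH m].
  by case: (m (f i)).
rewrite IH; congr sem; apply: funext => j.
by rewrite /set_cell (inj_eq fi).
Qed.

Lemma graft_out f T m j : (forall i, j <> f i) ->
  sem (graft f T End) m j = m j.
Proof.
move=> fj; elim: T m => //= [i t0 IH0 t1 IH1 m|i b t IH m].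
  by case: (m (f i)).
by rewrite IH /set_cell; case: eqP => // /fj.
Qed.

(** * Simulating the oracle *)

Section Simulation.

Variables (D D' : dynprob) (n M : nat).
Variable V : verifier (slice_oracle D' M) n.
Variable W : bool -> verifier no_oracle M.

Local Notation d := (depth (tree V)).
Local Notation xV := (in_len D V).
Local Notation xW b := (in_len D' (W b)).

(** A feed is a node of the tree, so one step of [V] makes at most [d] feeds and [d] slots
    suffice. *)
Definition sim_plen : nat :=
  plen V + d * plen (W true) + d * plen (W false).
Definition sim_rlen : nat :=
  d * rlen (W false) + d * rlen (W true) + rlen V + 1.

(* Cells below [aX] hold the update, the proof for V, and d proof slots for
   each of W true and W false. The reward follows [aX]; from the least
   significant bit: d slots for W false, d slots for W true, the reward of V,
   and a bit that is set iff all oracle answers were certified. The memories of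
   V, W false, W true and the flag [aBad] are interleaved from [aC] on. *)
Definition aX : nat := ulen D n + sim_plen.
Definition aP (b : bool) : nat :=
  if b then ulen D n + plen V else ulen D n + plen V + d * plen (W true).
Definition aS (b : bool) : nat :=
  if b then aX.+1 + d * rlen (W false) else aX.+1.
Definition aY : nat := aX.+1 + d * rlen (W false) + d * rlen (W true).
Definition aOk : nat := aY + rlen V.
Definition aC : nat := aOk.+1.
(** Residue classes modulo 4 keep the simulated memories apart at every index, so each can be
    treated as a full memory. *)
Definition aV (i : nat) : nat := aC + 4 * i.
Definition aW (b : bool) (i : nat) : nat :=
  if b then aC + 4 * i + 2 else aC + 4 * i + 1.
Definition aBad : nat := aC + 3.
Definition sim_space : nat :=
  aC + 4 * (space V + space (W true) + space (W false)) + 4.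

(** One step of [W b] on the update [w] with the proof in slot [e]. The reward is copied out to slot
    [e], while the bit x stays in the memory of [W b], where later queries read it. *)
Definition feed_tree (b : bool) (e : nat) (w : bitseq) (K : dtree) : dtree :=
  set_block (aW b) (nth false w) (ulen D' M)
    (copy_block (fun i => aP b + e * plen (W b) + i)
                (fun i => aW b (ulen D' M + i)) (plen (W b))
      (graft (aW b) (tree (W b))
        (copy_block (fun i => aW b ((xW b).+1 + i))
                    (fun i => aS b + e * rlen (W b) + i) (rlen (W b)) K))).

(** Slots from [k] on have been used. An uncertified query raises the flag and stops before [End],
    so x and [aOk] are not written. *)
Fixpoint sim (k : nat) (T : dtree) : dtree :=
  match T with
  | End =>
      copy_block (fun=> aV xV) (fun=> aX) 1
        (copy_block (fun i => aV (xV.+1 + i)) (fun i => aY + i) (rlen V)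
          (Write aOk true End))
  | Read i t0 t1 => Read (aV i) (sim k t0) (sim k t1)
  | Write i b t => Write (aV i) b (sim k t)
  | Feed w t => feed_tree true k.-1 w (feed_tree false k.-1 w (sim k.-1 t))
  | Ask t0 t1 =>
      Read (aW true (xW true))
        (Read (aW false (xW false)) (sim k t0) (Write aBad true End))
        (sim k t1)
  end.

Definition sim_tree : dtree :=
  set_block (fun i => aX + i) (fun=> false) sim_rlen.+1
    (Read aBad
      (copy_block id aV (ulen D n + plen V) (sim d (tree V)))
      End).

(** The output of step 0 counts too, so x starts as the initial x of [V]. The memories of [W] are
    prepared for the initial instance of the oracle. *)
Definition sim_prep (I0 : inst n) : memory := fun j =>
  if j < aC then (j == aX) && prep V I0 xV
  else
    let i := (j - aC) %/ 4 in
    let r := (j - aC) %% 4 in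
    if r == 0 then prep V I0 i
    else if r == 1 then prep (W false) (oinit V I0) i
    else if r == 2 then prep (W true) (oinit V I0) i
    else false.

Definition simV : verifier no_oracle n :=
  @Verifier no_oracle n sim_space sim_plen sim_rlen sim_prep (fun=> tt) sim_tree.

Ltac unfold_addr :=
  rewrite /= /sim_space /aBad /aW /aV /aC /aOk /aY /aS /aP /aX /sim_plen /sim_rlen
    /in_len /=.

Lemma slot_leq (e k w : nat) : e < k -> e * w + w <= k * w.
Proof. by move=> lt_e; nia. Qed.

(** * Oracle-freeness and depth of the simulating tree *)

Lemma free_feed b e w K : oracle_free K -> oracle_free (feed_tree b e w K).
Proof.
move=> fK; rewrite /feed_tree free_set_block free_copy_block free_graft //.
by rewrite free_copy_block.
Qed.

Lemma free_sim k T : oracle_free (sim k T).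
Proof.
elim: T k => //= [|i t0 IH0 t1 IH1 k|w t IH k|t0 IH0 t1 IH1 k].
- by rewrite free_copy_block.
- by rewrite IH0 IH1.
- by rewrite !free_feed.
by rewrite IH0 IH1.
Qed.

Lemma free_sim_tree : oracle_free sim_tree.
Proof. by rewrite /sim_tree free_set_block /= free_copy_block free_sim. Qed.

Definition feed_cost (b : bool) : nat :=
  ulen D' M + (plen (W b)).*2 + depth (tree (W b)) + (rlen (W b)).*2.

(** Charged per node of [T]: a feed costs one run of each [W b], a query two reads. *)
Definition sim_cost : nat := feed_cost true + feed_cost false + 2.

Lemma depth_feed b e w K :
  depth (feed_tree b e w K) <= feed_cost b + depth K.
Proof.
rewrite /feed_tree /feed_cost depth_set_block depth_copy_block.
set G := graft _ _ _; have : depth G <= _ := depth_graft _ _ _.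
by rewrite depth_copy_block; lia.
Qed.

Lemma depth_sim k T :
  depth (sim k T) <= depth T * sim_cost + (rlen V).*2 + 3.
Proof.
elim: T k => [|i t0 IH0 t1 IH1|i b t IH|w t IH|t0 IH0 t1 IH1] k.
(* The 3 accounts for copying x and writing [aOk]. *)
- by rewrite /= depth_copy_block /=; lia.
- by have := IH0 k; have := IH1 k => /=; rewrite /sim_cost; nia.
- by have := IH k => /=; rewrite /sim_cost; nia.
- have := IH k.-1; have := depth_feed false k.-1 w (sim k.-1 t).
  have := depth_feed true k.-1 w (feed_tree false k.-1 w (sim k.-1 t)).
  by rewrite /= /sim_cost; nia.
by have := IH0 k; have := IH1 k => /=; rewrite /sim_cost; nia.
Qed.

Lemma depth_sim_tree :
  depth sim_tree <=
  sim_rlen + (ulen D n + plen V).*2 + d * sim_cost + (rlen V).*2 + 5.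
Proof.
rewrite /sim_tree depth_set_block /= depth_copy_block maxn0.
by have := depth_sim d (tree V); lia.
Qed.

(** * Space used by the simulating tree *)

Hypothesis Vwf : well_formed D V.
Hypothesis Wwf : forall b, well_formed D' (W b).

Lemma below_feed b e w K : e < d -> addr_below sim_space K ->
  addr_below sim_space (feed_tree b e w K).
Proof.
move=> lt_e bK; rewrite /feed_tree.
have /andP[st bt] := (Wwf b); rewrite /in_len in st.
have hp := slot_leq (plen (W b)) lt_e; have hr := slot_leq (rlen (W b)) lt_e.
apply: below_set_block => [i lt_i|]; first by destruct b; unfold_addr; lia.
apply: below_copy_block => [i lt_i|].
  by destruct b; unfold_addr; lia.
apply: below_graft bt _ => [i lt_i|].
  by destruct b; unfold_addr; lia.
apply: below_copy_block => // i lt_i.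
by destruct b; unfold_addr; lia.
Qed.

Lemma below_sim k T : depth T <= k <= d -> addr_below (space V) T ->
  addr_below sim_space (sim k T).
Proof.
have /andP[sV _] := Vwf; have /andP[s1 _] := Wwf true.
have /andP[s0 _] := Wwf false; rewrite /in_len in sV s1 s0.
elim: T k => [|i t0 IH0 t1 IH1|i b t IH|w t IH|t0 IH0 t1 IH1] k /= kd.
- move=> _; set B := copy_block _ _ _ _.
  have bB : addr_below sim_space B.
    apply: below_copy_block => [j lt_j|/=]; first by unfold_addr; lia.
    by rewrite andbT; unfold_addr; lia.
  by rewrite bB !andbT; apply/and3P; split; unfold_addr; lia.
- case/and3P => lt_i b0 b1; rewrite IH0 ?IH1 ?andbT //; try lia.
  by unfold_addr; lia.
- by case/andP => lt_i bt; rewrite IH ?andbT //; unfold_addr; lia.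
- by move=> bt; apply: below_feed; last apply: below_feed; try apply: IH; lia.
case/andP => b0 b1; rewrite IH0 ?IH1 ?andbT //; try lia.
by apply/and3P; split; unfold_addr; lia.
Qed.

Lemma sim_well_formed : well_formed D simV.
Proof.
apply/andP; split; first by rewrite /in_len /=; unfold_addr; lia.
have /andP[sV bV] := Vwf; rewrite /in_len in sV.
apply: below_set_block => [i lt_i|]; first by move: lt_i; unfold_addr; lia.
rewrite [addr_below _ _]/= andbT; apply/andP; split; first by unfold_addr; lia.
apply: below_copy_block => [i lt_i|]; first by unfold_addr; lia.
by apply: below_sim => //; rewrite leqnn.
Qed.

(** * Memory effect of a single feed *)

Definition final_mem b (J0 : inst M) (h : history (W b)) : memory :=
  if run D' J0 h is Some c then c.1 else fun=> false.

Lemma out_x_final b J0 h : out_x D' J0 h = @final_mem b J0 h (xW b).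
Proof. by rewrite /out_x /final_mem; case: (run _ _ _). Qed.

Lemma out_y_final b J0 h :
  isSome (run D' J0 h) ->
  out_y D' J0 h = cell_val (@final_mem b J0 h) (xW b).+1 (rlen (W b)).
Proof. by rewrite /out_y /final_mem; case: (run _ _ _). Qed.

(** A run that is defined without an oracle meets no [Feed], so there [exec] agrees with the total
    [sem]. *)
Lemma final_mem_rcons b J0 h K p : isSome (run D' J0 (rcons h (K, p))) ->
  @final_mem b J0 (rcons h (K, p)) =
  sem (tree (W b))
    (load (ucode D' (last J0 (unzip1 h)) K ++ p) (final_mem J0 h)).
Proof.
rewrite /final_mem run_rcons; case: (run D' J0 h) => //= c.
rewrite /step; case E : (exec _ _) => [c'|] //= _.
exact: exec_no_oracle E.
Qed.

Lemma aV_inj : injective aV. Proof. by move=> i j; rewrite /aV; lia. Qed.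

Lemma aW_inj b : injective (aW b).
Proof. by move=> i j; rewrite /aW; case: b; lia. Qed.

Definition feed_mem (b : bool) (e : nat) (w : bitseq) (m : memory) : memory :=
  copy_mem (fun i => aW b ((xW b).+1 + i))
           (fun i => aS b + e * rlen (W b) + i) (rlen (W b))
    (sem (graft (aW b) (tree (W b)) End)
      (copy_mem (fun i => aP b + e * plen (W b) + i)
                (fun i => aW b (ulen D' M + i)) (plen (W b))
         (set_mem (aW b) (nth false w) (ulen D' M) m))).

Lemma sem_feed b e w K m :
  sem (feed_tree b e w K) m = sem K (feed_mem b e w m).
Proof.
by rewrite /feed_tree sem_set_block sem_copy_block sem_graft sem_copy_block.
Qed.

Lemma feed_mem_out b e w m j :
  (forall i, j <> aW b i) ->
  (forall i, i < rlen (W b) -> j <> aS b + e * rlen (W b) + i) ->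
  feed_mem b e w m j = m j.
Proof.
move=> jW jS; rewrite /feed_mem copy_mem_out // graft_out //.
by rewrite copy_mem_out ?set_mem_out // => i _; apply: jW.
Qed.

Lemma feed_mem_W b e (w : bitseq) (p : (plen (W b)).-tuple bool) m : e < d ->
  size w = ulen D' M ->
  (forall i, i < plen (W b) -> m (aP b + e * plen (W b) + i) = nth false p i) ->
  (fun i => feed_mem b e w m (aW b i)) =
  sem (tree (W b)) (load (w ++ p) (fun i => m (aW b i))).
Proof.
move=> lt_e sz_w mp; have hp := slot_leq (plen (W b)) lt_e.
have hr := slot_leq (rlen (W b)) lt_e.
rewrite -[RHS](_ : sem (tree (W b)) (fun i =>
  copy_mem (fun i => aP b + e * plen (W b) + i)
           (fun i => aW b (ulen D' M + i)) (plen (W b))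
         (set_mem (aW b) (nth false w) (ulen D' M) m) (aW b i)) = _); last first.
  (* Three ranges of [i]: the update, written bit by bit; the proof, copied from its slot; the rest,
     untouched. *)
  congr sem; apply: funext => i; rewrite /load size_cat sz_w size_tuple nth_cat sz_w.
  have [lt_i|le_i] := ltnP i (ulen D' M).
    rewrite ltn_addr // copy_mem_out => [|j lt_j /aW_inj]; last lia.
    by rewrite set_mem_in // => ? ? _ _; apply: aW_inj.
  have [lt_i|ge_i] := ltnP i (ulen D' M + plen (W b)).
    have -> : i = ulen D' M + (i - ulen D' M) by lia.
    rewrite (copy_mem_in (g := fun i => aW b (ulen D' M + i))); first last.
    - lia.
    - by move=> j j' lt_j lt_j'; destruct b; unfold_addr; lia.
    - by move=> j j' lt_j lt_j' /aW_inj; lia.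
    rewrite addKn -mp; last lia.
    by rewrite set_mem_out // => j lt_j; destruct b; unfold_addr; lia.
  rewrite copy_mem_out => [|j lt_j /aW_inj]; last lia.
  by rewrite set_mem_out // => j lt_j /aW_inj; lia.
rewrite -graft_in; last exact: aW_inj.
apply: funext => i; rewrite /feed_mem copy_mem_out // => j lt_j.
by destruct b; unfold_addr; lia.
Qed.

Lemma feed_mem_S b e (w : bitseq) m : e < d ->
  cell_val (feed_mem b e w m) (aS b + e * rlen (W b)) (rlen (W b)) =
  cell_val (fun i => feed_mem b e w m (aW b i)) (xW b).+1 (rlen (W b)).
Proof.
move=> lt_e; have hr := slot_leq (rlen (W b)) lt_e.
apply: eq_cell_val => i lt_i; rewrite /feed_mem.
rewrite (copy_mem_in (g := fun i => aS b + e * rlen (W b) + i)) //.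
- rewrite copy_mem_out // => j lt_j.
  by destruct b; unfold_addr; lia.
- by lia.
by move=> j j' lt_j lt_j'; destruct b; unfold_addr; lia.
Qed.

(** * Simulating the tree of the oracle verifier *)

Hypothesis WP : forall b (J0 : inst M) (h : history (W b)),
  instance_sequence D' J0 h ->
  [/\ isSome (run D' J0 h),
      last_answer D' J0 h = ~~ b -> out_x D' J0 h = ~~ b
    & reward_maximizing D' J0 h -> last_answer D' J0 h = b ->
      out_x D' J0 h = b].

Fixpoint feeds (T : dtree) (c : config (slice_oracle D' M)) : seq (inst M) :=
  let: (m, s) := c in
  match T with
  | End => [::]
  | Read i t0 t1 => feeds (if m i then t1 else t0) c
  | Write i b t => feeds t (set_cell m i b, s)
  | Feed w t =>
      if ofeed s w is Some s' then
        s' :: feeds t ((m, s') : config (slice_oracle D' M))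
      else [::]
  | Ask t0 t1 => feeds (if oans s then t1 else t0) c
  end.

Lemma size_feeds T c : size (feeds T c) <= depth T.
Proof.
elim: T c => [|i t0 IH0 t1 IH1|i b t IH|w t IH|t0 IH0 t1 IH1] [m s] //=.
- by case: (m i); [apply: leq_trans (IH1 _) _|apply: leq_trans (IH0 _) _]; lia.
- by apply: leq_trans (IH _) _.
- by case: [pick K | _] => //= s'; rewrite ltnS.
by case: (ans D' s); [apply: leq_trans (IH1 _) _|apply: leq_trans (IH0 _) _]; lia.
Qed.

(** [J0] is the initial instance of the oracle and [s] its current one; [hW b] collects the feeds of
    all steps so far, since [W b] is never restarted. *)
Record related (J0 : inst M) (m mV : memory) (s : inst M)
    (hW : forall b, history (W b)) : Prop := Related {
  rel_V : (fun i => m (aV i)) = mV;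
  rel_W : forall b, (fun i => m (aW b i)) = final_mem J0 (hW b);
  rel_seq : forall b, instance_sequence D' J0 (hW b);
  rel_last : forall b, last J0 (unzip1 (hW b)) = s;
  rel_bad : m aBad = false
}.

(** Soundness of [W true] and [W false] makes certificates trustworthy; with optimal proofs, the one
    whose side is correct is complete and delivers its certificate. *)
Lemma certified J0 m mV s hW : related J0 m mV s hW ->
  [/\ m (aW true (xW true)) -> ans D' s,
      m (aW false (xW false)) = false -> ans D' s = false
    & (forall b, reward_maximizing D' J0 (hW b)) ->
      m (aW true (xW true)) = false -> m (aW false (xW false)) = false].
Proof.
case=> _ rW rs rl _.
have mE b : m (aW b (xW b)) = out_x D' J0 (hW b).
  by rewrite out_x_final -rW.
have aE b : last_answer D' J0 (hW b) = ans D' s by rewrite /last_answer rl.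
have [_ x1 y1] := WP (rs true); have [_ x0 y0] := WP (rs false).
rewrite !mE; rewrite !aE in x0 x1 y0 y1; split.
- by case: (ans D' s) x1 => // ->.
- by case: (ans D' s) x0 => // ->.
move=> hm; have := y1 (hm true); have := y0 (hm false).
by case: (ans D' s) => [_ -> //|-> //].
Qed.

Lemma related_feed J0 m mV s hW w s' e
    (pi : forall b, nat -> (plen (W b)).-tuple bool) : e < d ->
  ofeed (o := slice_oracle D' M) s w = Some s' ->
  related J0 m mV s hW ->
  (forall b i, i < plen (W b) ->
     m (aP b + e * plen (W b) + i) = nth false (pi b e) i) ->
  let m' := feed_mem false e w (feed_mem true e w m) in
  let hW' b := rcons (hW b) (s', pi b e) in
  [/\ related J0 m' mV s' hW',
      forall b, cell_val m' (aS b + e * rlen (W b)) (rlen (W b)) =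
                out_y D' J0 (hW' b)
    & forall j, (forall b i, j <> aW b i) ->
        (forall b i, i < rlen (W b) -> j <> aS b + e * rlen (W b) + i) ->
        m' j = m j].
Proof.
move=> lt_e /= + [rV rW rs rl rb] mp.
(* The instance [K] picked by the oracle has [w] as its update code, so loading [w] is a genuine
   step of each [W b]. *)
case: pickP => // K /andP[uK /eqP cK] [<-] {s'}.
have hp b := slot_leq (plen (W b)) lt_e; have hr b := slot_leq (rlen (W b)) lt_e.
set m1 := feed_mem true e w m; set m2 := feed_mem false e w m1.
have szw : size w = ulen D' M by rewrite -cK size_tuple.
have frame j : (forall b i, j <> aW b i) ->
    (forall b i, i < rlen (W b) -> j <> aS b + e * rlen (W b) + i) ->
    m2 j = m j.
  by move=> jW jS; rewrite /m2 /m1 !feed_mem_out // => i; try exact: jW; exact: jS.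
have rs' b : instance_sequence D' J0 (rcons (hW b) (K, pi b e)).
  by rewrite instance_sequence_rcons rs rl.
have def b : isSome (run D' J0 (rcons (hW b) (K, pi b e))).
  by case: (WP (rs' b)).
have m1p b i : i < plen (W b) ->
    m1 (aP b + e * plen (W b) + i) = nth false (pi b e) i.
  move=> lt_i; rewrite -mp // /m1 feed_mem_out // => j.
    by have := hp b; destruct b; unfold_addr; lia.
  by move=> lt_j; have := hp b; have := hr true; destruct b; unfold_addr; lia.
have m1W : (fun i => m1 (aW true i)) = final_mem J0 (rcons (hW true) (K, pi true e)).
  rewrite (feed_mem_W lt_e szw (mp true)) final_mem_rcons // rl rW.
  by rewrite -cK.
(* [W true] runs first: the second feed must preserve its memory, and the first must have preserved
   the memory and proof slot of [W false]. *)
have m2W : forall b, (fun i => m2 (aW b i)) = final_mem J0 (rcons (hW b) (K, pi b e)).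
  case.
    rewrite -m1W; apply: funext => i; rewrite /m2 feed_mem_out // => j.
      by unfold_addr; lia.
    by move=> lt_j; have := hr false; unfold_addr; lia.
  rewrite (feed_mem_W lt_e szw (m1p false)) final_mem_rcons // rl -(rW false) cK.
  congr (sem _ (load _ _)); apply: funext => i; rewrite /m1 feed_mem_out // => j.
    by unfold_addr; lia.
  by move=> lt_j; have := hr true; unfold_addr; lia.
split=> //.
  split=> //.
  - rewrite -rV; apply: funext => i; apply: frame => b j.
      by destruct b; unfold_addr; lia.
    by move=> lt_j; have := hr b; destruct b; unfold_addr; lia.
  - by move=> b; rewrite unzip1_rcons last_rcons.
  - rewrite -rb; apply: frame => b j.
      by destruct b; unfold_addr; lia.
    by move=> lt_j; have := hr b; destruct b; unfold_addr; lia.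
move=> b; rewrite out_y_final // -m2W.
case: b; last by rewrite feed_mem_S.
rewrite -[LHS](@eq_cell_val m1 _ (aS true + e * rlen (W true))).
  rewrite feed_mem_S //; apply: eq_cell_val => i lt_i.
  by rewrite -[LHS]/((fun i => m1 (aW true i)) _) m1W -m2W.
move=> i lt_i; rewrite /m2 feed_mem_out // => j.
  by have := hr true; unfold_addr; lia.
by move=> lt_j; have := hr true; have := hr false; unfold_addr; lia.
Qed.

Lemma eq_related J0 m mV s (hW hW' : forall b, history (W b)) :
  (forall b, hW b = hW' b) -> related J0 m mV s hW -> related J0 m mV s hW'.
Proof. by move=> e [rV rW rs rl rb]; split=> // b; rewrite -e. Qed.

Lemma related_set_cell J0 m mV s hW i v : related J0 m mV s hW ->
  related J0 (set_cell m (aV i) v) (set_cell mV i v) s hW.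
Proof.
case=> rV rW rs rl rb; split=> // [|b|].
- by rewrite -rV; apply: funext => j; rewrite /set_cell (inj_eq aV_inj).
- rewrite -rW; apply: funext => j; rewrite /set_cell; case: eqP => //.
  by destruct b; unfold_addr; lia.
by rewrite -rb /set_cell; case: eqP => //; unfold_addr; lia.
Qed.

(** Induction on [T]; [k] bounds the feeds still to come. At an uncertified query, [certified] shows
    that the current histories, prefixes of the [hW' b], are not both maximizing. The last clause
    protects the rewards that earlier feeds left in slots [k] and above. *)
Lemma sim_spec J0 T k m mV s hW c'
    (pi : forall b, nat -> (plen (W b)).-tuple bool) :
  depth T <= k <= d ->
  exec (O := slice_oracle D' M) T (mV, s) = Some c' ->
  related J0 m mV s hW ->
  (forall b e i, e < k -> i < plen (W b) ->
     m (aP b + e * plen (W b) + i) = nth false (pi b e) i) ->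
  (forall b i, i < k * rlen (W b) -> m (aS b + i) = false) ->
  m aOk = false -> m aX = false ->
  let Ks := feeds T (mV, s) in
  let m' := sem (sim k T) m in
  let hW' b := hW b ++ entries (pi b) k Ks in
  [/\ m' aBad, m' aOk = false, m' aX = false
    & ~ (forall b, reward_maximizing D' J0 (hW' b))] \/
  [/\ related J0 m' c'.1 c'.2 hW', m' aOk, m' aX = c'.1 xV,
      cell_val m' aY (rlen V) = cell_val c'.1 xV.+1 (rlen V)
    & forall b,
      cell_val m' (aS b) (k * rlen (W b)) = slots_reward D' J0 (hW b) (pi b) k Ks /\
      forall i, k * rlen (W b) <= i < d * rlen (W b) ->
        m' (aS b + i) = m (aS b + i)].
Proof.
elim: T k m mV s hW => [|i t0 IH0 t1 IH1|i v t IH|w t IH|t0 IH0 t1 IH1]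
  k m mV s hW kd.
- case=> <- rel mp mS mOk mX; rewrite /sim !sem_copy_block /=; right.
  set m1 := set_cell m aX _; set m2 := copy_mem _ _ _ m1.
  have fr j : j != aOk -> (forall i, i < rlen V -> j <> aY + i) -> j != aX ->
      set_cell m2 aOk true j = m j.
    move=> jOk jY jX; rewrite /set_cell (negPf jOk) /m2 copy_mem_out //.
    by rewrite /m1 /set_cell (negPf jX).
  case: (rel) => rV rW rs rl rb.
  split.
  - split=> // [|b|b|b|].
    + rewrite -rV; apply: funext => j; by apply: fr; unfold_addr; lia.
    + rewrite cats0 -rW; apply: funext => j.
      by apply: fr; try move=> i lt_i; destruct b; unfold_addr; lia.
    + by rewrite cats0.
    + by rewrite cats0.
    by rewrite -rb; apply: fr; try move=> i lt_i; unfold_addr; lia.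
  - by rewrite /set_cell eqxx.
  - rewrite /set_cell; case: eqP; first by unfold_addr; lia.
    move=> _; rewrite /m2 copy_mem_out => [|i lt_i]; last by unfold_addr; lia.
    by rewrite /m1 /set_cell eqxx -rV.
  - apply: eq_cell_val => i lt_i; rewrite /set_cell.
    case: eqP; first by unfold_addr; lia.
    move=> _; rewrite /m2 (copy_mem_in (g := fun i => aY + i)) //.
    + rewrite /m1 /set_cell; case: eqP; first by unfold_addr; lia.
      by rewrite -rV.
    + by move=> j j' _ _; lia.
    by move=> j j' lt_j lt_j'; unfold_addr; lia.
  move=> b; split=> [|i /andP[_ lt_i]].
    apply: cell_val0 => i lt_i; rewrite -[RHS](mS b i lt_i).
    have le_k : k * rlen (W b) <= d * rlen (W b) by rewrite leq_mul2r; lia.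
    by apply: fr; try move=> j lt_j; destruct b; unfold_addr; lia.
  by apply: fr; try move=> j lt_j; destruct b; unfold_addr; lia.
- move=> /= + rel mp mS mOk mX; rewrite /= in kd.
  have -> : m (aV i) = mV i by rewrite -(rel_V rel).
  by case: (mV i) => ex; [apply: IH1|apply: IH0] => //; lia.
- move=> /= ex rel mp mS mOk mX; rewrite /= in kd.
  have fr j : j < aC -> set_cell m (aV i) v j = m j.
    move=> lt_j; rewrite /set_cell; case: eqP => // e.
    by move: lt_j; rewrite e; unfold_addr; lia.
  have le_d b e : e < k -> e * plen (W b) + plen (W b) <= d * plen (W b).
    by move=> lt_e; apply: slot_leq; lia.
  have le_r b : k * rlen (W b) <= d * rlen (W b) by rewrite leq_mul2r; lia.
  have frS b j : j < d * rlen (W b) ->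
      set_cell m (aV i) v (aS b + j) = m (aS b + j).
    by move=> lt_j; apply: fr; destruct b; unfold_addr; lia.
  have := IH k (set_cell m (aV i) v) _ s hW _ ex (related_set_cell i v rel).
  case=> //.
  + lia.
  + move=> b e j lt_e lt_j; rewrite fr ?mp //.
    by have := le_d b e lt_e; destruct b; unfold_addr; lia.
  + by move=> b j lt_j; rewrite frS ?mS //; apply: leq_trans (le_r b).
  + by rewrite fr //; unfold_addr; lia.
  + by rewrite fr //; unfold_addr; lia.
  + by left.
  case=> r1 r2 r3 r4 r5; right; split=> // b; have [r6 r7] := r5 b; split=> //.
  by move=> j lt_j; rewrite r7 // frS //; case/andP: lt_j.
- case: k kd => [//|k] kd /=; case E: [pick K | _] => [s'|] // ex rel mp mS mOk mX.
  have lt_k : k < d by rewrite /= in kd; lia.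
  have [rel' rS fr] := @related_feed J0 m mV s hW w s' k pi lt_k E rel
    (fun b i => mp b k i (leqnn _)).
  rewrite !sem_feed; set m1 := feed_mem false _ _ _ in rel' rS fr *.
  have le_d b e : e < k.+1 -> e * plen (W b) + plen (W b) <= d * plen (W b).
    by move=> lt_e; apply: slot_leq; lia.
  have le_r b : k * rlen (W b) + rlen (W b) <= d * rlen (W b).
    exact: slot_leq.
  have frS b j : j < k * rlen (W b) \/ k.+1 * rlen (W b) <= j < d * rlen (W b) ->
      m1 (aS b + j) = m (aS b + j).
    move=> lt_j; apply: fr => [b' i|b' i lt_i].
      by have := le_r b; destruct b, b'; unfold_addr; lia.
    have := le_r b'; have := le_r b; rewrite mulSn in lt_j.
    by destruct b, b'; unfold_addr; lia.
  have frO j : j < aS false \/ j = aOk -> m1 j = m j.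
    move=> lt_j; apply: fr => [b' i|b' i lt_i].
      by move: lt_j; destruct b'; unfold_addr; lia.
    by have := le_r b'; move: lt_j; destruct b'; unfold_addr; lia.
  have := IH k m1 _ s' _ _ ex rel'.
  case=> //.
  + by rewrite /= in kd; lia.
  + move=> b e j lt_e lt_j; rewrite frO ?mp //; first exact: ltnW.
    by left; have := le_d b e (ltnW lt_e); destruct b; unfold_addr; lia.
  + by move=> b j lt_j; rewrite frS ?mS //; [rewrite mulSn; lia|left].
  + by rewrite frO //; right.
  + by rewrite frO //; left; unfold_addr; lia.
  + case=> r1 r2 r3 r4; left; split=> // hm; apply: r4 => b.
    by have := hm b; rewrite -cat_rcons.
  case=> r1 r2 r3 r4 r5; right; split=> //.
    by apply: eq_related r1 => b; rewrite cat_rcons.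
  move=> b; have [r6 r7] := r5 b; split.
    (* Slot [k] is the most significant of the [k.+1] slots; this feed writes it and later feeds use
       only lower ones. *)
    rewrite mulSn addnC cell_valD r6; congr (_ + _ * _).
    rewrite -rS; apply: eq_cell_val => i lt_i; rewrite -addnA r7 ?addnA //.
    by have := le_r b; lia.
  move=> j; rewrite mulSn => lt_j; rewrite r7; last lia.
  by apply: frS; rewrite mulSn; right.
move=> /= + rel mp mS mOk mX; rewrite /= in kd.
have [c1 c0 cm] := certified rel.
case E1: (m _).
  by rewrite (c1 E1) => ex; apply: IH1 => //; lia.
rewrite /=; case E0: (m _); last first.
  by rewrite (c0 E0) => ex; apply: IH0 => //; lia.
move=> ex; left; rewrite /= /set_cell; split.
- by rewrite eqxx.
- by case: eqP => //; unfold_addr; lia.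
- by case: eqP => //; unfold_addr; lia.
(* Maximality of the histories up to this query would have certified the answer. *)
move=> hm; move: E0; rewrite cm // => b.
exact: reward_maximizing_catl (hm b).
Qed.

(** * Splitting and assembling proofs *)

Implicit Types (q : sim_plen.-tuple bool) (p : (plen V).-tuple bool).

Definition projV q : (plen V).-tuple bool :=
  [tuple nth false q i | i < plen V].

(** [aP b] is a memory address; the proof [q] is loaded from cell [ulen D n] on, hence the
    subtraction. *)
Definition projW q b e : (plen (W b)).-tuple bool :=
  [tuple nth false q (aP b - ulen D n + e * plen (W b) + i) | i < plen (W b)].

Lemma nth_mktuple_nat (l : nat) (f : nat -> bool) (i : nat) : i < l ->
  nth false [tuple f j | j < l] i = f i.
Proof.
by move=> lt_i; rewrite -[i]/(nat_of_ord (Ordinal lt_i)) -tnth_nth tnth_mktuple.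
Qed.

Lemma nth_projV q i : i < plen V -> nth false (projV q) i = nth false q i.
Proof. exact: (@nth_mktuple_nat _ (nth false q)). Qed.

Lemma nth_projW q b e i : i < plen (W b) ->
  nth false (projW q b e) i =
  nth false q (aP b - ulen D n + e * plen (W b) + i).
Proof.
exact: (@nth_mktuple_nat _
  (fun i => nth false q (aP b - ulen D n + e * plen (W b) + i))).
Qed.

(** The slots occupy disjoint ranges, so all component proofs can be prescribed independently;
    division with remainder recovers slot and position. *)
Lemma proj_surj p (pi : forall b, nat -> (plen (W b)).-tuple bool) :
  exists q, projV q = p /\ forall b e, e < d -> projW q b e = pi b e.
Proof.
pose w1 := plen (W true); pose w0 := plen (W false); pose v := plen V.
pose f i := if i < v then nth false p i else
  if i < v + d * w1 then nth false (pi true ((i - v) %/ w1)) ((i - v) %% w1)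
  else let j := i - (v + d * w1) in nth false (pi false (j %/ w0)) (j %% w0).
have slotP w e i : i < w -> ((e * w + i) %/ w = e) * ((e * w + i) %% w = i).
  move=> lt_i; have w_gt0 : 0 < w by lia.
  by rewrite divnMDl // modnMDl divn_small // modn_small // addn0.
exists [tuple f i | i < sim_plen]; split.
  apply: eq_from_tnth => i; rewrite !(tnth_nth false).
  rewrite nth_projV // (@nth_mktuple_nat _ f) /f; last first.
    by rewrite /sim_plen; have := ltn_ord i; lia.
  by rewrite ltn_ord.
move=> b e lt_e; apply: eq_from_tnth => i; have lt_i := ltn_ord i.
have hp := slot_leq (plen (W b)) lt_e.
rewrite !(tnth_nth false) nth_projW // (@nth_mktuple_nat _ f) /f; last first.
  by destruct b; unfold_addr; lia.
destruct b.
- have -> : aP true - ulen D n + e * w1 + i = v + (e * w1 + i).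
    by rewrite /aP /v; lia.
  rewrite ltnNge leq_addr /= ltn_add2l; case: ltnP; last by rewrite /w1; lia.
  by move=> _; rewrite addKn !slotP.
have -> : aP false - ulen D n + e * w0 + i = (v + d * w1) + (e * w0 + i).
  by rewrite /aP /v /w1; lia.
case: ltnP; first by lia.
by move=> _; case: ltnP => [|_] /=; [lia|rewrite addKn !slotP].
Qed.

(** * One step of the new verifier *)

Definition sim_step (I J : inst n) q (m : memory) : memory :=
  sem sim_tree (load (ucode D I J ++ q) m).

(** The flag lies beyond the cells loaded or cleared, and once set it ends the step right after the
    clearing. *)
Lemma sim_step_bad I J q (m : memory) : m aBad ->
  sim_step I J q m aBad /\ sim_step I J q m aX = false.
Proof.
move=> mB; rewrite /sim_step /sim_tree sem_set_block.
set m1 := set_mem _ _ _ _; rewrite [sem (Read _ _ _) _]/=.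
have m1B : m1 aBad.
  rewrite /m1 set_mem_out => [|i]; last by unfold_addr; lia.
  rewrite /load ifF // size_cat !size_tuple; unfold_addr; lia.
rewrite m1B /=; split=> //.
rewrite -[aX]addn0 /m1 (set_mem_in (g := fun i => aX + i)) //.
by move=> i j _ _; lia.
Qed.

(** The reward of a step whose queries were all certified; the summand [2 ^ rlen V] is the bit
    [aOk]. *)
Definition sim_reward (y r1 r0 : nat) : nat :=
  r0 + 2 ^ (d * rlen (W false)) *
  (r1 + 2 ^ (d * rlen (W true)) * (y + 2 ^ rlen V)).

(** If the flag is raised, the top bit of the reward is missing, so the step is beaten by every
    [sim_reward]. *)
Lemma sim_step_spec J0 (I J : inst n) q m mV s hW c' :
  related J0 m mV s hW ->
  let c := (load (ucode D I J ++ projV q) mV, s) in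
  exec (O := slice_oracle D' M) (tree V) c = Some c' ->
  let Ks := feeds (tree V) c in
  let m' := sim_step I J q m in
  let hW' b := hW b ++ entries (projW q b) d Ks in
  let y := cell_val m' aX.+1 sim_rlen in
  [/\ m' aBad, m' aX = false,
      ~ (forall b, reward_maximizing D' J0 (hW' b))
    & forall z r1 r0, y < sim_reward z r1 r0] \/
  [/\ related J0 m' c'.1 c'.2 hW', m' aX = c'.1 xV
    & y = sim_reward (cell_val c'.1 xV.+1 (rlen V))
            (slots_reward D' J0 (hW true) (projW q true) d Ks)
            (slots_reward D' J0 (hW false) (projW q false) d Ks)].
Proof.
move=> [rV rW rs rl rb] /= ex.
have yE m' : cell_val m' aX.+1 sim_rlen =
    cell_val m' (aS false) (d * rlen (W false)) + 2 ^ (d * rlen (W false)) *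
    (cell_val m' (aS true) (d * rlen (W true)) + 2 ^ (d * rlen (W true)) *
     (cell_val m' aY (rlen V) + 2 ^ rlen V * m' aOk)).
  by rewrite /sim_rlen -!addnA !cell_valD cell_val1 /aOk /aY -!addnA.
rewrite /sim_step /sim_tree sem_set_block.
set m1 := set_mem _ _ _ _; rewrite [sem (Read _ _ _) _]/=.
have m1out j : j < aX \/ aC <= j -> m1 j = load (ucode D I J ++ q) m j.
  by move=> lt_j; rewrite /m1 set_mem_out // => i; move: lt_j; unfold_addr; lia.
have m1in j : aX <= j < aC -> m1 j = false.
  move=> lt_j; have -> : j = aX + (j - aX) by lia.
  rewrite /m1 (set_mem_in (g := fun i => aX + i)) //; first by move=> ? ? _ _; lia.
  by move: lt_j; unfold_addr; lia.
have m1B : m1 aBad = false.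
  rewrite m1out; last by right; unfold_addr; lia.
  by rewrite /load ifF // size_cat !size_tuple; unfold_addr; lia.
rewrite m1B sem_copy_block; set m2 := copy_mem _ _ _ _.
have m2E j : j < aC -> m2 j = m1 j.
  by move=> lt_j; rewrite /m2 copy_mem_out // => i _; rewrite /aV; lia.
have rel : related J0 m2 (load (ucode D I J ++ projV q) mV) s hW.
  split=> // [|b|].
  - apply: funext => i; rewrite /load size_cat !size_tuple.
    case: ltnP => [lt_i|le_i].
      rewrite /m2 copy_mem_in //; first last.
      + by move=> a b lt_a lt_b; unfold_addr; lia.
      + by move=> a b _ _; apply: aV_inj.
      rewrite m1out; last by left; unfold_addr; lia.
      rewrite /load size_cat !size_tuple ifT; last by unfold_addr; lia.
      rewrite !nth_cat !size_tuple; case: ltnP => // le_i.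
      by rewrite nth_projV //; lia.
    rewrite /m2 copy_mem_out => [|j lt_j /aV_inj]; last lia.
    rewrite m1out; last by right; unfold_addr; lia.
    by rewrite /load ifF ?size_cat ?size_tuple -?rV //; unfold_addr; lia.
  - rewrite -rW; apply: funext => i; rewrite /m2 copy_mem_out; last first.
      by move=> j _; destruct b; unfold_addr; lia.
    rewrite m1out; last by right; destruct b; unfold_addr; lia.
    by rewrite /load ifF ?size_cat ?size_tuple //; destruct b; unfold_addr; lia.
  by rewrite /m2 copy_mem_out // => j _; unfold_addr; lia.
have := @sim_spec J0 (tree V) d m2 _ s hW c' (projW q) _ ex rel.
case.
- by rewrite leqnn.
- move=> b e i lt_e lt_i; have hp := slot_leq (plen (W b)) lt_e.
  rewrite m2E; last by destruct b; unfold_addr; lia.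
  rewrite m1out; last by left; destruct b; unfold_addr; lia.
  rewrite /load ifT ?size_cat ?size_tuple; last by destruct b; unfold_addr; lia.
  rewrite nth_cat size_tuple ifF; last by destruct b; unfold_addr; lia.
  rewrite nth_projW //; congr nth; destruct b; unfold_addr; lia.
- move=> b i lt_i; rewrite m2E ?m1in //; destruct b; unfold_addr; lia.
- by rewrite m2E ?m1in //; unfold_addr; lia.
- by rewrite m2E ?m1in //; unfold_addr; lia.
- case=> r1 r2 r3 r4; left; split=> // z s1 s0; rewrite yE r2 muln0 addn0.
  rewrite /sim_reward.
  set m' := sem _ _.
  have := cell_val_lt m' (aS false) (d * rlen (W false)).
  have := cell_val_lt m' (aS true) (d * rlen (W true)).
  have := cell_val_lt m' aY (rlen V).
  set A := 2 ^ (_ * rlen (W false)); set B := 2 ^ (_ * rlen (W true)).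
  set a := cell_val _ _ _; set b := cell_val _ _ _; set c := cell_val _ _ _.
  move=> lt_a lt_b lt_c.
  have h1 : b + B * a < s1 + B * (z + 2 ^ rlen V) by nia.
  by nia.
case=> r1 r2 r3 r4 r5; right; split=> //.
by rewrite yE r2 muln1 r4 (r5 true).1 (r5 false).1.
Qed.

(** * Reward-maximizing sequences and whole runs *)

Hypothesis VP : forall (I0 : inst n) (h : history V), instance_sequence D I0 h ->
  [/\ isSome (run D I0 h),
      last_answer D I0 h = false -> out_x D I0 h = false
    & reward_maximizing D I0 h -> last_answer D I0 h = true ->
      out_x D I0 h = true].

Definition historyV (h : history simV) : history V :=
  [seq (x.1, projV x.2) | x <- h].

Lemma unzip1_historyV h : unzip1 (historyV h) = unzip1 h.
Proof. by rewrite /unzip1 /historyV -map_comp. Qed.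

Lemma historyV_rcons h J q :
  historyV (rcons h (J, q)) = rcons (historyV h) (J, projV q).
Proof. exact: map_rcons. Qed.

Lemma run_simV_rcons I0 (h : history simV) J q m :
  run D I0 h = Some (m, tt) ->
  run D I0 (rcons h (J, q : (plen simV).-tuple bool)) =
  Some (sim_step (last I0 (unzip1 h)) J q m, tt).
Proof.
by rewrite run_rcons => ->; rewrite /step exec_oracle_free ?free_sim_tree.
Qed.

Lemma sim_reward_lex_y y y' r1 r1' r0 r0' :
  r0' < 2 ^ (d * rlen (W false)) -> r1' < 2 ^ (d * rlen (W true)) ->
  sim_reward y r1 r0 <= sim_reward y' r1' r0' -> y <= y'.
Proof.
by move=> lt0 lt1 /(leq_lex lt0)/(leq_lex lt1); rewrite leq_add2r.
Qed.

Lemma sim_reward_lex_1 y r1 r1' r0 r0' :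
  r0' < 2 ^ (d * rlen (W false)) ->
  sim_reward y r1 r0 <= sim_reward y r1' r0' -> r1 <= r1'.
Proof. by move=> lt0 /(leq_lex lt0); rewrite leq_add2r. Qed.

Lemma sim_reward_lex_0 y r1 r0 r0' :
  sim_reward y r1 r0 <= sim_reward y r1 r0' -> r0 <= r0'.
Proof. by rewrite leq_add2r. Qed.

(** Each claim compares [q] with a competitor [q'] whose slots are all optimal, so that its queries
    are certified and its reward is a [sim_reward]. The claims follow the weights: flag, reward of
    [V], slots of [W true], slots of [W false]. *)
Lemma sim_maximizing J0 I0 (h : history simV) J q m mV s hW c' :
  run D I0 h = Some (m, tt) ->
  run D I0 (historyV h) = Some (mV, s) ->
  related J0 m mV s hW ->
  instance_sequence D I0 (rcons h (J, q : (plen simV).-tuple bool)) ->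
  let c := (load (ucode D (last I0 (unzip1 h)) J ++ projV q) mV, s) in
  exec (O := slice_oracle D' M) (tree V) c = Some c' ->
  (forall b, reward_maximizing D' J0 (hW b)) ->
  (forall q', out_y D I0 (rcons h (J, q')) <= out_y D I0 (rcons h (J, q))) ->
  [/\ ~~ sim_step (last I0 (unzip1 h)) J q m aBad,
      forall p, out_y D I0 (rcons (historyV h) (J, p)) <=
                out_y D I0 (rcons (historyV h) (J, projV q))
    & forall b, reward_maximizing D' J0
        (hW b ++ entries (projW q b) d (feeds (tree V) c))].
Proof.
move=> hr hVr rel hs c ex hm qm.
set I := last _ _ in c ex *.
have yE q' : out_y D I0 (rcons h (J, q' : (plen simV).-tuple bool)) =
    cell_val (sim_step I J q' m) aX.+1 sim_rlen.
  by rewrite /out_y (run_simV_rcons _ _ hr).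
have {}qm q' : cell_val (sim_step I J q' m) aX.+1 sim_rlen <=
               cell_val (sim_step I J q m) aX.+1 sim_rlen.
  by rewrite -!yE.
have cP p : exists c2 : config (slice_oracle D' M),
    exec (tree V) (load (ucode D I J ++ p) mV, s) = Some c2 /\
    out_y D I0 (rcons (historyV h) (J, p)) = cell_val c2.1 xV.+1 (rlen V).
  have hs' : instance_sequence D I0 (rcons (historyV h) (J, p)).
    by move: hs; rewrite !instance_sequence_rcons /instance_sequence unzip1_historyV.
  have [] := VP hs'; rewrite /out_y run_rcons hVr /step unzip1_historyV -/I.
  by case E: (exec _ _) => [c2|] // _ _ _; exists c2.
have szK c1 : size (feeds (tree V) c1) <= d by apply: size_feeds.
(* The feeds of [V] depend on its proof [p] but not on the slots, so optimal slots can be chosen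
   after [p]. *)
have best p : exists q', projV q' = p /\ forall b,
    reward_maximizing D' J0 (hW b ++ entries (projW q' b) d
      (feeds (tree V) (load (ucode D I J ++ p) mV, s))).
  set Ks := feeds _ _.
  have [pi1 pi1P] := exists_best_entries (szK _ : size Ks <= d) (hm true).
  have [pi0 pi0P] := exists_best_entries (szK _ : size Ks <= d) (hm false).
  pose pi b : nat -> (plen (W b)).-tuple bool :=
    if b is true then pi1 else pi0.
  have [q' [qV qW]] := proj_surj p pi.
  exists q'; split=> // b; rewrite (eq_entries (pi' := pi b)) //.
  - by case: b.
  - exact: szK.
  by move=> e; apply: qW.
have rlt b q' c1 : slots_reward D' J0 (hW b) (projW q' b) d (feeds (tree V) c1)
    < 2 ^ (d * rlen (W b)).
  exact: slots_reward_lt.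
have [[bB _ _ lt_y]|[rel' _ y'E]] := sim_step_spec rel ex.
  have [q' [qV qW]] := best (projV q).
  have ex' : exec (O := slice_oracle D' M) (tree V)
      (load (ucode D I J ++ projV q') mV, s) = Some c' by rewrite qV.
  have [[_ _ []]|[_ _ y2E]] := sim_step_spec rel ex'; first by rewrite qV.
  by have := qm q'; rewrite leqNgt y2E lt_y.
have okq : ~~ sim_step I J q m aBad by rewrite (rel_bad rel').
have yV p : out_y D I0 (rcons (historyV h) (J, p)) <=
            out_y D I0 (rcons (historyV h) (J, projV q)).
  have [c2 [ex2 ->]] := cP p; have [c3 [ex3 ->]] := cP (projV q).
  have [q' [qV qW]] := best p; rewrite -qV in ex2 qW.
  have [[_ _ []]|[_ _ y2E]] := sim_step_spec rel ex2 => //.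
  have := qm q'; rewrite y2E y'E; move: ex; rewrite ex3 => -[<-].
  exact: sim_reward_lex_y.
have cmp q' : projV q' = projV q ->
  (forall b, reward_maximizing D' J0 (hW b ++ entries (projW q' b) d
      (feeds (tree V) c))) ->
  sim_reward (cell_val c'.1 xV.+1 (rlen V))
    (slots_reward D' J0 (hW true) (projW q' true) d (feeds (tree V) c))
    (slots_reward D' J0 (hW false) (projW q' false) d (feeds (tree V) c)) <=
  sim_reward (cell_val c'.1 xV.+1 (rlen V))
    (slots_reward D' J0 (hW true) (projW q true) d (feeds (tree V) c))
    (slots_reward D' J0 (hW false) (projW q false) d (feeds (tree V) c)).
  move=> qV qW.
  have ex' : exec (O := slice_oracle D' M) (tree V)
      (load (ucode D I J ++ projV q') mV, s) = Some c' by rewrite qV.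
  have [[_ _ []]|[_ _ y2E]] := sim_step_spec rel ex'; first by rewrite qV.
  by rewrite -y'E; move: y2E; rewrite qV => <-.
(* By [lex_maximizing] only maximizing [pi1] compete; optimal proofs for [W false] then keep [q']
   unflagged, and their lower weight does not affect the comparison. *)
have max1 : reward_maximizing D' J0
    (hW true ++ entries (projW q true) d (feeds (tree V) c)).
  apply: lex_maximizing => // pi1 pi1P.
  have [pi0 pi0P] := exists_best_entries (szK c) (hm false).
  pose pi b : nat -> (plen (W b)).-tuple bool :=
    if b is true then pi1 else pi0.
  have [q' [qV qW]] := proj_surj (projV q) pi.
  have := cmp q' qV; rewrite (eq_slots_reward _ _ _ (pi' := pi1)) //; last first.
    by move=> e; apply: (qW true).
  move=> cq; apply: sim_reward_lex_1 (cq _) => // b.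
  rewrite (eq_entries (pi' := pi b)) //; first by case: b.
  by move=> e; apply: qW.
(* The slots of [W true] are kept from [q], where [max1] makes them optimal; all higher digits then
   agree. *)
have max0 : reward_maximizing D' J0
    (hW false ++ entries (projW q false) d (feeds (tree V) c)).
  apply: lex_maximizing => // pi0 pi0P.
  pose pi b : nat -> (plen (W b)).-tuple bool :=
    if b is true then projW q true else pi0.
  have [q' [qV qW]] := proj_surj (projV q) pi.
  have := cmp q' qV.
  rewrite (eq_slots_reward _ _ _ (pi := projW q' true)
    (pi' := projW q true)) //; last first.
    by move=> e; apply: (qW true).
  rewrite (eq_slots_reward _ _ _ (pi := projW q' false)
    (pi' := pi0)) //; last first.
    by move=> e; apply: (qW false).
  move=> cq; apply: sim_reward_lex_0 (cq _) => b.
  rewrite (eq_entries (pi' := pi b)) //; first by case: b.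
  by move=> e; apply: qW.
by split=> //; case.
Qed.

Lemma related_prep (I0 : inst n) :
  related (oinit V I0) (sim_prep I0) (prep V I0) (oinit V I0) (fun=> [::]).
Proof.
have big j r : r < 4 ->
    [/\ (aC + 4 * j + r < aC) = false, (aC + 4 * j + r - aC) %/ 4 = j
      & (aC + 4 * j + r - aC) %% 4 = r] by move=> lt_r; split; lia.
split=> // [|b|].
- apply: funext => i; have [] := big i 0 isT; rewrite addn0 /sim_prep /aV.
  by move=> -> -> ->.
- apply: funext => i; rewrite /final_mem /run /= /sim_prep /aW.
  by case: b; [have [-> -> ->] := big i 2 isT|have [-> -> ->] := big i 1 isT].
by have [] := big 0 3 isT; rewrite muln0 addn0 /sim_prep /aBad => -> -> ->.
Qed.

(** A flagged run outputs 0 and, by [sim_maximizing] at the step that raised the flag, is not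
    maximizing; any other run mirrors a run of [V] with the same x. *)
Lemma sim_run_inv (I0 : inst n) (h : history simV) :
  instance_sequence D I0 h -> exists m, run D I0 h = Some (m, tt) /\
  ([/\ m aBad, m aX = false & ~ reward_maximizing D I0 h] \/
   exists mV s hW, [/\ run D I0 (historyV h) = Some (mV, s),
     related (oinit V I0) m mV s hW, m aX = mV xV
   & reward_maximizing D I0 h -> reward_maximizing D I0 (historyV h) /\
       forall b, reward_maximizing D' (oinit V I0) (hW b)]).
Proof.
elim/last_ind: h => [_|h [J q] IH hs].
  exists (sim_prep I0); split=> //; right.
  exists (prep V I0), (oinit V I0), (fun=> [::]); split=> //.
  - exact: related_prep.
  - by rewrite /sim_prep eqxx ifT //; unfold_addr; lia.
  by move=> _; split=> [|b]; apply: reward_maximizing_nil.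
have /IH[m [hr inv]] : instance_sequence D I0 h.
  by move: hs; rewrite instance_sequence_rcons => /andP[].
exists (sim_step (last I0 (unzip1 h)) J q m); split.
  exact: run_simV_rcons.
case: inv => [[mB _ nm]|[mV [s [hW [hVr rel mX hmax]]]]].
  left; have [? ?] := @sim_step_bad (last I0 (unzip1 h)) J q m mB; split=> //.
  by move/reward_maximizing_rcons => [].
have hs' : instance_sequence D I0 (rcons (historyV h) (J, projV q)).
  by move: hs; rewrite !instance_sequence_rcons /instance_sequence unzip1_historyV.
have [] := VP hs'; rewrite run_rcons hVr /step unzip1_historyV /=.
case ex: (exec _ _) => [c'|] // _ _ _.
have mxP : reward_maximizing D I0 (rcons h (J, q)) -> _ :=
  fun hm => let: conj h1 h2 := proj1 (reward_maximizing_rcons _ _ _ _ _) hm in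
  sim_maximizing hr hVr rel hs ex (hmax h1).2 h2.
have [[bB bX _ _]|[rel' x'E _]] := sim_step_spec rel ex.
  by left; split=> // /mxP[]; rewrite bB.
right; exists c'.1, c'.2; eexists; split; [|exact: rel'|exact: x'E|].
  rewrite historyV_rcons run_rcons hVr /step unzip1_historyV /= ex.
  by case: (c').
move=> hm; have [_ yV mW] := mxP hm; split=> //.
rewrite historyV_rcons; apply/reward_maximizing_rcons; split=> //.
by case/reward_maximizing_rcons: hm => /hmax[].
Qed.

Lemma sim_verifies (I0 : inst n) (h : history simV) :
  instance_sequence D I0 h ->
  [/\ isSome (run D I0 h),
      last_answer D I0 h = false -> out_x D I0 h = false
    & reward_maximizing D I0 h -> last_answer D I0 h = true ->
      out_x D I0 h = true].
Proof.
move=> hs; have [m [hr inv]] := sim_run_inv hs.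
have xE : out_x D I0 h = m aX by rewrite /out_x hr.
rewrite xE hr; case: inv => [[_ -> nm]|[mV [s [hW [hVr _ -> hmax]]]]]; first by split.
have hs' : instance_sequence D I0 (historyV h).
  by rewrite /instance_sequence unzip1_historyV.
have aE : last_answer D I0 h = last_answer D I0 (historyV h).
  by rewrite /last_answer unzip1_historyV.
have [_ x0 x1] := VP hs'; rewrite /out_x hVr -aE in x0 x1.
by split=> // /hmax[hm _]; apply: x1.
Qed.

End Simulation.

(** * Collapse of the hierarchy *)

Local Open Scope classical_set_scope.

Lemma polylogD (f1 f2 : nat -> nat) :
  polylog_bounded f1 -> polylog_bounded f2 ->
  polylog_bounded (fun n => f1 n + f2 n).
Proof. exact: bounded_inD. Qed.

Lemma polylogM (f1 f2 : nat -> nat) :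
  polylog_bounded f1 -> polylog_bounded f2 ->
  polylog_bounded (fun n => f1 n * f2 n).
Proof. exact: bounded_inM. Qed.

Lemma polylog_const (k : nat) : polylog_bounded (fun=> k).
Proof. exact: bounded_in_const. Qed.

Lemma polylog_double (f : nat -> nat) :
  polylog_bounded f -> polylog_bounded (fun n => (f n).*2).
Proof.
by move=> fP; under eq_fun do rewrite -addnn; apply: polylogD.
Qed.

(** The verifiers of the oracle problem run at size [m n]; as [m] is polynomial, [log2 (m n)] is
    polylogarithmic in [n], and so are their costs. *)
Lemma NPdy_with_low (D : dynprob) :
  NPdy_with (NPdy `&` coNPdy) D -> NPdy D.
Proof.
case=> D' [m [[[W1 [wf1 d1 s1 [p1 r1] vf1]] [W0 [wf0 d0 s0 [p0 r0] vf0]]] mP]].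
case=> V [wfV dV sV [pV rV] vfV].
pose W n (b : bool) := if b then W1 (m n) else W0 (m n).
have wfW n b : well_formed D' (W n b) by case: b; [apply: wf1|apply: wf0].
have dW b : polylog_bounded (fun n => depth (tree (W n b))).
  by case: b; [apply: polylog_comp d1 mP|apply: polylog_comp d0 mP].
have pW b : polylog_bounded (fun n => plen (W n b)).
  by case: b; [apply: polylog_comp p1 mP|apply: polylog_comp p0 mP].
have rW b : polylog_bounded (fun n => rlen (W n b)).
  by case: b; [apply: polylog_comp r1 mP|apply: polylog_comp r0 mP].
have sW b : poly_bounded (fun n => space (W n b)).
  by case: b; [apply: poly_comp s1 mP|apply: poly_comp s0 mP].
have uD : polylog_bounded (ulen D) by apply: theta_log_polylog (ulen_theta D).
have uD' : polylog_bounded (fun n => ulen D' (m n)).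
  by apply: polylog_comp mP; apply: theta_log_polylog (ulen_theta D').
have plP : polylog_bounded (fun n => sim_plen (V n) (W n)).
  by do ?apply: polylogD; do ?apply: polylogM.
have rlP : polylog_bounded (fun n => sim_rlen (V n) (W n)).
  by do ?apply: polylogD; do ?apply: polylogM; try exact: polylog_const.
exists (fun n => simV D (V n) (W n)); split=> //.
- by move=> n; apply: sim_well_formed.
- apply: bounded_in_le (fun n => @depth_sim_tree D D' n (m n) (V n) (W n)) _.
  have cP b : polylog_bounded (fun n => feed_cost D' (W n) b).
    by do ?apply: polylogD; do ?apply: polylog_double.
  apply: polylogD (polylog_const _); apply: polylogD (polylog_double rV).
  apply: polylogD; last first.
    apply: polylogM dV _; apply: polylogD (polylog_const _).
    exact: polylogD (cP true) (cP false).
  by apply: polylogD rlP _; apply: polylog_double; apply: polylogD.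
- have cP : polylog_bounded (fun n => aC D (V n) (W n)).
    apply: (@bounded_in_le _ _ (fun n => ulen D n + sim_plen (V n) (W n) +
                                 sim_rlen (V n) (W n) + 1)).
      by move=> n; rewrite /aC /aOk /aY /aX /sim_rlen; lia.
    by do ?apply: polylogD => //; apply: polylog_const.
  apply: (bounded_inD (g := id)) (bounded_in_const _ _).
  apply: (bounded_inD (g := id)) (polylog_poly cP) _.
  apply: (bounded_inM (g := id)) (bounded_in_const _ _) _.
  apply: (bounded_inD (g := id)) (sW false).
  exact: (bounded_inD (g := id)) sV (sW true).
(* The runs of [W] take one step per feed and can be longer than [h], so their guarantees are used
   at any length. *)
move=> L _ n I0 h _ hs; apply: sim_verifies hs => //.
- case=> J0 h' hs'; first exact: verifies_any_length vf1 _ _ _ hs'.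
  exact: verifies_any_length vf0 _ _ _ hs'.
by move=> I1 h' hs'; apply: (verifies_any_length vfV hs').
Qed.

Lemma has_verifier_with_mono b (A B : set dynprob) D :
  A `<=` B -> has_verifier_with b A D -> has_verifier_with b B D.
Proof. by move=> AB [D' [m [/AB]]]; exists D', m. Qed.

Lemma coNPdy_with_compl (C : set dynprob) D :
  coNPdy_with C D -> NPdy_with C (compl D).
Proof.
by case=> D' [m [CD' mP hv]]; exists D', m; split=> //; apply: has_verifier_compl hv.
Qed.

Theorem mainTheorem4 : NPdy `<=` coNPdy -> PHdy = NPdy `&` coNPdy.
Proof.
move=> sub.
(* For [D] in coNP, [compl D] is in NP, hence in coNP, so [D] is in NP. *)
have sub' : coNPdy `<=` NPdy.
  move=> D /has_verifier_compl; move=> /(sub (compl D)).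
  exact: has_verifier_compl_inv.
(* By induction the oracle problem is in NP, and by hypothesis also in coNP, so the oracle can be
   removed. *)
have SigmaP i : Sigmady i `<=` NPdy.
  elim: i => [|[|i] IH] // D DP; apply: NPdy_with_low.
  apply: (@has_verifier_with_mono _ (Sigmady i.+1)) DP => E /IH EP.
  by split=> //; apply: sub.
(* Complementing turns the coNP verifier into an NP verifier with the same oracle, to which the
   elimination applies. *)
have PiP i : Pidy i `<=` coNPdy.
  case: i => [|[|i]] // D /coNPdy_with_compl DP.
  apply: (@has_verifier_compl_inv true); apply: NPdy_with_low.
  apply: (@has_verifier_with_mono _ (Sigmady i.+1)) DP => E /SigmaP EP.
  by split=> //; apply: sub.
apply/seteqP; split=> [D [i _ [/SigmaP DP|/PiP DP]]|D [DP _]].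
- by split=> //; apply: sub.
- by split=> //; apply: sub'.
by exists 1 => //; left.
Qed.
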